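(* The category of Boolean inverse semigroups and callitic morphisms is dually equivalent to the category of Boolean groupoids and coherent, continuous covering functors.
   Context: **Inverse semigroups.** For an inverse semigroup $S$, $\mathsf{E}(S)$ is its set of idempotents, and $\leq$ is the natural partial order ($a\leq b$ iff $a=be$ for some idempotent $e$). Elements $a,b$ are compatible, written $a\sim b$, if $a^{-1}b$ and $ab^{-1}$ are idempotents. An inverse semigroup with zero is distributive if every compatible pair $a\sim b$ has a join $a\vee b$ (with respect to $\leq$) and multiplication distributes over such joins on both sides. A generalized Boolean algebra is a distributive lattice with bottom element in which each non-zero principal order-ideal $a^{\downarrow}=\{x : x\leq a\}$ is a Boolean algebra. A Boolean inverse semigroup is a distributive inverse semigroup $S$ such that $\mathsf{E}(S)$ is a generalized Boolean algebra. **Callitic morphisms.** A morphism $\theta\colon S\to T$ of Boolean inverse semigroups is a semigroup homomorphism preserving zero and binary compatible joins. It is proper if each $t\in T$ can be written $t=\bigvee_{i=1}^n t_i$ where, for each $i$, $t_i\leq\theta(s_i)$ for some $s_i\in S$. It is weakly-meet-preserving if whenever $t\leq\theta(a),\theta(b)$ there exists $c\leq a,b$ such that $t\leq\theta(c)$. It is callitic if it is both proper and weakly-meet-preserving. **Boolean groupoids.** A groupoid $G$ is a (small) category in which every element (arrow) is invertible; its identities are identified with elements of $G$ and form the set $G_o$; $\mathbf{d}(g)=g^{-1}g$, $\mathbf{r}(g)=gg^{-1}$, and $gh$ is defined iff $\mathbf{d}(g)=\mathbf{r}(h)$. A topological groupoid is a groupoid with a topology such that multiplication (on the subspace $\{(g,h)\in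 G\times G:\mathbf{d}(g)=\mathbf{r}(h)\}$) and inversion are continuous; $G_o$ has the subspace topology. It is étale if $\mathbf{d}\colon G\to G$ is a local homeomorphism. It is not assumed Hausdorff. A locally compact Boolean space is a $0$-dimensional (having a base of clopen sets), locally compact Hausdorff space. A Boolean groupoid is an étale topological groupoid whose space of identities $G_o$ is a locally compact Boolean space. **Functors.** A functor $\phi\colon G\to H$ of groupoids is a covering functor if for each identity $e\in G_o$ the induced map $\{g\in G:\mathbf{d}(g)=e\}\to\{h\in H:\mathbf{d}(h)=\phi(e)\}$ is a bijection. A continuous function is coherent if inverse images of compact-open subsets are compact-open. Categories are dually equivalent if one is equivalent to the opposite of the other. *)

(* Defs.v *)
From HB Require Import structures.
From mathcomp Require Import all_boot.
From mathcomp Require Import all_classical.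
From mathcomp Require Import topology.

Set Implicit Arguments.
Unset Strict Implicit.
Unset Printing Implicit Defensive.

Local Open Scope classical_set_scope.
Local Open Scope group_scope.

Record category := Category {
  ob :> Type;
  hom : ob -> ob -> Type;
  idc : forall x, hom x x;
  compc : forall x y z, hom y z -> hom x y -> hom x z;
  compc_idl : forall x y (f : hom x y), compc (idc y) f = f;
  compc_idr : forall x y (f : hom x y), compc f (idc x) = f;
  compcA : forall x y z t (h : hom z t) (g : hom y z) (f : hom x y),
    compc h (compc g f) = compc (compc h g) f
}.
Arguments hom {_} _ _.
Arguments idc {_} _.
Arguments compc {_ _ _ _} _ _.

Definition opposite (C : category) : category :=
  @Category (ob C) (fun x y => @hom C y x) (fun x => idc x)
    (fun x y z g f => compc f g)
    (fun x y f => compc_idr f)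
    (fun x y f => compc_idl f)
    (fun x y z t h g f => esym (compcA f g h)).

Record functor (C D : category) := Functor {
  fobj :> C -> D;
  fmap : forall x y, hom x y -> hom (fobj x) (fobj y);
  fmap_id : forall x : C, fmap (idc x) = idc (fobj x);
  fmap_comp : forall x y z (g : hom y z) (f : hom x y),
    fmap (compc g f) = compc (fmap g) (fmap f)
}.
Arguments fmap {_ _} _ {_ _} _.

Definition functor_id (C : category) : functor C C :=
  @Functor C C (fun x => x) (fun x y f => f)
    (fun=> erefl) (fun x y z g f => erefl).

Definition functor_comp (C D E : category)
    (G : functor D E) (F : functor C D) : functor C E :=
  @Functor C E (fun x => G (F x)) (fun x y f => fmap G (fmap F f))
    (fun x => etrans (congr1 (fmap G) (fmap_id F x)) (fmap_id G (F x)))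
    (fun x y z g f => etrans (congr1 (fmap G) (fmap_comp F g f))
                             (fmap_comp G (fmap F g) (fmap F f))).

Record natural_iso (C D : category) (F G : functor C D) := NaturalIso {
  nat_to : forall x, hom (F x) (G x);
  nat_from : forall x, hom (G x) (F x);
  nat_toK : forall x, compc (nat_from x) (nat_to x) = idc (F x);
  nat_fromK : forall x, compc (nat_to x) (nat_from x) = idc (G x);
  nat_natural : forall x y (f : hom x y),
    compc (nat_to y) (fmap F f) = compc (fmap G f) (nat_to x)
}.

Definition equivalent (C D : category) : Prop :=
  exists (F : functor C D) (G : functor D C),
    inhabited (natural_iso (functor_comp G F) (functor_id C)) /\
    inhabited (natural_iso (functor_comp F G) (functor_id D)).

Definition dually_equivalent (C D : category) : Prop :=
  equivalent C (opposite D).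

(* Everything is relative to a subset [A] of the carrier, so as to apply to the
   idempotents of an inverse semigroup and to their principal order ideals. *)
Section OrderedSubsets.
Variables (T : Type) (le : T -> T -> Prop) (A : set T).

Definition is_lub (X : set T) (z : T) : Prop :=
  [/\ A z, (forall x, X x -> le x z) &
      forall w, A w -> (forall x, X x -> le x w) -> le z w].

Definition is_glb (X : set T) (z : T) : Prop :=
  [/\ A z, (forall x, X x -> le z x) &
      forall w, A w -> (forall x, X x -> le w x) -> le w z].

Definition is_bottom (z : T) : Prop := A z /\ forall x, A x -> le z x.

Definition is_top (z : T) : Prop := A z /\ forall x, A x -> le x z.

Definition is_partial_order : Prop :=
  [/\ (forall x, A x -> le x x),
      (forall x y, A x -> A y -> le x y -> le y x -> x = y) &
      (forall x y z, A x -> A y -> A z -> le x y -> le y z -> le x z)].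

Definition is_distributive_lattice : Prop :=
  is_partial_order /\
  exists join meet : T -> T -> T,
    [/\ (forall x y, A x -> A y -> is_lub [set x; y] (join x y)),
        (forall x y, A x -> A y -> is_glb [set x; y] (meet x y)) &
        (forall x y z, A x -> A y -> A z ->
           meet x (join y z) = join (meet x y) (meet x z))].

Definition is_boolean_algebra : Prop :=
  is_distributive_lattice /\
  exists bot top : T,
    [/\ is_bottom bot, is_top top &
        forall x, A x -> exists y,
          [/\ A y, is_lub [set x; y] top & is_glb [set x; y] bot]].

End OrderedSubsets.

Definition is_generalized_boolean_algebra
    (T : Type) (le : T -> T -> Prop) (A : set T) : Prop :=
  is_distributive_lattice le A /\
  exists bot : T, is_bottom le A bot /\
    forall a, A a -> a <> bot ->
      is_boolean_algebra le [set x | A x /\ le x a].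

HB.mixin Record Semigroup_isInverse S of Semigroup S := {
  sinv : S -> S;
  mulVK : forall x : S, x * sinv x * x = x;
  mulKV : forall x : S, sinv x * x * sinv x = sinv x;
  sinv_unique : forall x y : S, x * y * x = x -> y * x * y = y -> y = sinv x
}.

#[short(type="inverseSemigroupType")]
HB.structure Definition InverseSemigroup :=
  {S of Semigroup_isInverse S & Semigroup S}.

HB.mixin Record Semigroup_hasZero S of Semigroup S := {
  szero : S;
  szerol : forall x : S, szero * x = szero;
  szeror : forall x : S, x * szero = szero
}.

#[short(type="inverseSemigroup0Type")]
HB.structure Definition InverseSemigroup0 :=
  {S of Semigroup_hasZero S & InverseSemigroup S}.

Section NaturalOrder.
Variable S : inverseSemigroupType.
Implicit Types a b : S.

Definition idempotents : set S := [set e : S | e * e = e].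

Definition nle a b : Prop := exists2 e, idempotents e & a = b * e.

Definition compatible a b : Prop :=
  idempotents (sinv a * b) /\ idempotents (a * sinv b).

Definition is_join (X : set S) (j : S) : Prop := is_lub nle setT X j.

End NaturalOrder.

Definition is_distributive (S : inverseSemigroup0Type) : Prop :=
  (forall a b : S, compatible a b -> exists j, is_join [set a; b] j) /\
  (forall a b c j : S, compatible a b -> is_join [set a; b] j ->
     is_join [set c * a; c * b] (c * j) /\ is_join [set a * c; b * c] (j * c)).

HB.mixin Record InverseSemigroup0_isBoolean S of InverseSemigroup0 S := {
  boolean_distributive : is_distributive S;
  boolean_idempotents :
    is_generalized_boolean_algebra (@nle S) (@idempotents S)
}.

#[short(type="booleanInverseSemigroupType")]
HB.structure Definition BooleanInverseSemigroup :=
  {S of InverseSemigroup0_isBoolean S & InverseSemigroup0 S}.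

Section Callitic.
Variables (S T : inverseSemigroup0Type) (theta : S -> T).

Definition is_morphism : Prop :=
  [/\ {morph theta : a b / a * b},
      theta (@szero S) = @szero T &
      forall a b j, compatible a b -> is_join [set a; b] j ->
        is_join [set theta a; theta b] (theta j)].

(* Allowing the empty family, whose join is zero, changes nothing: the family
   consisting of zero alone has the same join. *)
Definition is_proper : Prop :=
  forall t : T, exists ts : seq T,
    is_join [set` ts] t /\
    forall x, x \in ts -> exists s : S, nle x (theta s).

Definition is_weakly_meet_preserving : Prop :=
  forall (t : T) (a b : S), nle t (theta a) -> nle t (theta b) ->
    exists c : S, [/\ nle c a, nle c b & nle t (theta c)].

End Callitic.

Record callitic (S T : inverseSemigroup0Type) := Callitic {
  callitic_fun :> S -> T;
  callitic_morphism : is_morphism callitic_fun;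
  callitic_proper : is_proper callitic_fun;
  callitic_wmp : is_weakly_meet_preserving callitic_fun
}.

Section InverseSemigroupTheory.
Variable S : inverseSemigroupType.
Implicit Types a b e f s x y : S.

Lemma sinvK x : sinv (sinv x) = x.
Proof. by apply/esym/sinv_unique; [exact: mulKV|exact: mulVK]. Qed.

Lemma sinv_idem e : idempotents e -> sinv e = e.
Proof. by move=> /= ee; apply/esym/sinv_unique; rewrite !ee. Qed.

Lemma idem_mul e f : idempotents e -> idempotents f -> idempotents (e * f).
Proof.
rewrite /idempotents /= => ee ff.
have h1 := mulVK (e * f); have h2 := mulKV (e * f).
set x := sinv (e * f) in h1 h2; rewrite !mulgA in h1 h2.
have xE : f * x * e = x.
  apply: sinv_unique; rewrite !mulgA.
    by rewrite -(mulgA e f f) ff -(mulgA _ e e) ee.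
  rewrite -(mulgA _ e e) ee -(mulgA _ f f) ff.
  by move: (congr1 (fun u => f * u * e) h2); rewrite !mulgA.
have xx : idempotents x.
  rewrite /idempotents /= -{1 2}xE !mulgA.
  by move: (congr1 (fun u => f * u * e) h2); rewrite !mulgA xE.
have := sinv_idem xx; rewrite sinvK => xef; rewrite -mulgA -/x.
by move: xx; rewrite /idempotents /= -xef !mulgA.
Qed.

Lemma idemC e f : idempotents e -> idempotents f -> e * f = f * e.
Proof.
move=> ie if_; have ief := idem_mul ie if_; have ife := idem_mul if_ ie.
rewrite -(sinv_idem ief); apply/esym/sinv_unique.
  rewrite !mulgA -(mulgA e f f) if_ -(mulgA _ e e) ie.
  by rewrite -[RHS]ief !mulgA.
rewrite !mulgA -(mulgA f e e) ie -(mulgA _ f f) if_.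
by rewrite -[RHS]ife !mulgA.
Qed.

Lemma idemVM x : idempotents (sinv x * x).
Proof. by rewrite /idempotents /= mulgA mulKV. Qed.

Lemma idemMV x : idempotents (x * sinv x).
Proof. by rewrite /idempotents /= mulgA mulVK. Qed.

Lemma sinvM x y : sinv (x * y) = sinv y * sinv x.
Proof.
have C := idemC (idemMV y) (idemVM x); rewrite !mulgA in C.
apply/esym/sinv_unique; rewrite !mulgA.
  have -> : x * y * sinv y * sinv x * x * y =
      x * (y * sinv y * sinv x * x) * y by rewrite !mulgA.
  by rewrite C !mulgA mulVK -!mulgA (mulgA y) mulVK.
have -> : sinv y * sinv x * x * y * sinv y * sinv x =
    sinv y * (sinv x * x * y * sinv y) * sinv x by rewrite !mulgA.
by rewrite -C !mulgA mulKV -!mulgA (mulgA (sinv x)) mulKV.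
Qed.

Lemma nle_refl x : nle x x.
Proof. by exists (sinv x * x); [exact: idemVM|rewrite mulgA mulVK]. Qed.

Lemma nle_trans y x z : nle x y -> nle y z -> nle x z.
Proof.
move=> [e ie ->] [f jf ->]; exists (f * e); last by rewrite mulgA.
exact: idem_mul.
Qed.

Lemma nle_compatible s a b : nle a s -> nle b s -> compatible a b.
Proof.
move=> [e ie ->] [f jf ->]; split.
  rewrite sinvM (sinv_idem ie) mulgA -(mulgA e).
  exact/idem_mul/jf/idem_mul/idemVM.
rewrite sinvM (sinv_idem jf) mulgA -(mulgA s e f).
have ief := idem_mul ie jf; move: (e * f) ief => g ief.
rewrite /idempotents /=.
have -> : s * g * sinv s * (s * g * sinv s) =
    s * (g * (sinv s * s)) * g * sinv s by rewrite !mulgA.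
by rewrite (idemC ief (idemVM s)) !mulgA mulVK -(mulgA s g g) ief.
Qed.

End InverseSemigroupTheory.

Section JoinTheory.
Variables S T : booleanInverseSemigroupType.

Lemma nle0 (R : inverseSemigroup0Type) (x : R) : nle (@szero R) x.
Proof. by exists (@szero R); rewrite ?szeror // /idempotents /= szerol. Qed.

Lemma nle_homo (theta : S -> T) a b :
  {morph theta : a b / a * b} -> nle a b -> nle (theta a) (theta b).
Proof.
move=> tM [e ie ->]; exists (theta e); last by rewrite tM.
by rewrite /idempotents /= -tM ie.
Qed.

Lemma compatible_homo (theta : S -> T) a b : {morph theta : a b / a * b} ->
  compatible a b -> compatible (theta a) (theta b).
Proof.
move=> tM [h1 h2].
have tV x : sinv (theta x) = theta (sinv x).
  by apply/esym/sinv_unique; rewrite -!tM (mulVK, mulKV).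
by split; rewrite /idempotents /= tV -!tM; congr theta.
Qed.

Lemma finite_join (h : S -> T) (xs : seq S) (s : S) :
  h (@szero S) = @szero T ->
  (forall a b j, compatible a b -> is_join [set a; b] j ->
    is_join [set h a; h b] (h j)) ->
  (forall x, x \in xs -> nle x s) ->
  exists j, [/\ is_join [set` xs] j, nle j s & is_join [set` map h xs] (h j)].
Proof.
move=> h0 hJ; elim: xs => [_|x xs IH le_xs].
  exists (@szero S); split; [|exact: nle0|rewrite h0].
    by split=> // w _ _; exact: nle0.
  by split=> // w _ _; exact: nle0.
have [j [[_ jub jlub] js [_ hjub hjlub]]] : exists j, [/\ is_join [set` xs] j,
    nle j s & is_join [set` map h xs] (h j)].
  by apply: IH => y yxs; apply: le_xs; rewrite inE yxs orbT.
have xs_ : nle x s by apply: le_xs; rewrite inE eqxx.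
have cxj := nle_compatible xs_ js.
have [k kJ] := (@boolean_distributive S).1 _ _ cxj.
have [_ hkub hklub] := hJ _ _ _ cxj kJ; have [_ kub klub] := kJ.
exists k; split.
- split=> // [y|w _ ubw] /=.
    rewrite inE => /orP[/eqP->|yxs]; first by apply: kub; left.
    by apply: (nle_trans (jub _ yxs)); apply: kub; right.
  apply: klub => // y [->|->]; first by apply: ubw; rewrite /= inE eqxx.
  by apply: jlub => // z zxs; apply: ubw; rewrite /= inE zxs orbT.
- by apply: klub => // y [->|->].
- split=> // [y|w _ ubw] /=.
    rewrite inE => /orP[/eqP->|yxs]; first by apply: hkub; left.
    by apply: (nle_trans (hjub _ yxs)); apply: hkub; right.
  apply: hklub => // y [->|->]; first by apply: ubw; rewrite /= inE eqxx.
  by apply: hjlub => // z zxs; apply: ubw; rewrite /= inE zxs orbT.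
Qed.

End JoinTheory.

Lemma callitic_eq (S T : inverseSemigroup0Type) (f g : callitic S T) :
  f =1 g -> f = g.
Proof.
case: f g => [f ? ? ?] [g ? ? ?] /= /funext fg; subst g.
by congr Callitic; exact: Prop_irrelevance.
Qed.

Section CalliticCategory.

Definition callitic_id (S : booleanInverseSemigroupType) : callitic S S.
Proof.
exists idfun; first by [].
  move=> t; exists [:: t]; split.
    split=> // [x /=|w _]; first by rewrite inE => /eqP->; exact: nle_refl.
    by apply; rewrite /= inE.
  by move=> x _; exists x; exact: nle_refl.
by move=> t a b ta tb; exists t; split=> //; exact: nle_refl.
Defined.

Variables S T U : booleanInverseSemigroupType.
Variables (psi : callitic T U) (theta : callitic S T).

Lemma callitic_comp_morphism : is_morphism (psi \o theta).
Proof.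
have [tM t0 tJ] := callitic_morphism theta.
have [pM p0 pJ] := callitic_morphism psi.
split=> [a b|| a b j cab jab] /=; rewrite ?tM ?t0 //.
by apply: pJ; [exact: compatible_homo|exact: tJ].
Qed.

Lemma callitic_comp_proper : is_proper (psi \o theta).
Proof.
have [tM t0 tJ] := callitic_morphism theta.
have [pM p0 pJ] := callitic_morphism psi.
move=> u; have [us [[_ uub ulub] us_le]] := callitic_proper psi u.
have /choice[vs vsP] x : exists vs : seq U, x \in us ->
    is_join [set` vs] x /\
    forall y, y \in vs -> exists s, nle y (psi (theta s)).
  have [xus|] := boolP (x \in us); last by exists [::].
  have [t [e ie xE]] := us_le _ xus.
  have [ts [[_ tub tlub] ts_le]] := callitic_proper theta t.
  pose h y := psi y * e.
  have [j [jJ jt hj]] : exists j, [/\ is_join [set` ts] j, nle j t &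
      is_join [set` map h ts] (h j)].
    apply: finite_join => //; first by rewrite /h p0 szerol.
    move=> a b j cab jab; have cp := compatible_homo pM cab.
    by have [] := (@boolean_distributive U).2 _ _ e _ cp (pJ _ _ _ cab jab).
  have jE : j = t.
    have [f jf jE] := jt.
    have [g ig tE] : nle t j by case: jJ => _ jub _; exact: tlub.
    rewrite jE {1}tE jE -!mulgA (idemC ig jf) !mulgA -(mulgA t f f) jf.
    by rewrite -jE -tE.
  exists (map h ts) => _; split; first by rewrite xE -jE.
  move=> _ /mapP[y /ts_le[s ys] ->]; exists s.
  apply: nle_trans (nle_homo pM ys); exists e => //.
exists (flatten (map vs us)); split; last first.
  by move=> y /flatten_mapP[x xus yx]; exact: (vsP x xus).2.
split=> // [y /= /flatten_mapP[x xus yx]|w _ ubw].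
  have [[_ xub _] _] := vsP x xus.
  by apply: (@nle_trans _ x); [exact: xub|exact: uub].
apply: ulub => // x /= xus; have [[_ _ xlub] _] := vsP x xus.
by apply: xlub => // y yx; apply: ubw => /=; apply/flatten_mapP; exists x.
Qed.

Lemma callitic_comp_wmp : is_weakly_meet_preserving (psi \o theta).
Proof.
have [pM _ _] := callitic_morphism psi.
move=> u a b /= ua ub; have [t [ta tb ut]] := callitic_wmp ua ub.
have [c [ca cb tc]] := callitic_wmp ta tb; exists c; split=> //.
exact: nle_trans ut (nle_homo pM tc).
Qed.

Definition callitic_comp : callitic S U :=
  Callitic callitic_comp_morphism callitic_comp_proper callitic_comp_wmp.

End CalliticCategory.

Definition boolean_inverse_semigroups : category :=
  @Category booleanInverseSemigroupType (fun S T => callitic S T)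
    callitic_id (fun S T U psi theta => callitic_comp psi theta)
    (fun S T f => @callitic_eq S T (callitic_comp (callitic_id T) f) f (fun=> erefl))
    (fun S T f => @callitic_eq S T (callitic_comp f (callitic_id S)) f (fun=> erefl))
    (fun S T U V h g f => @callitic_eq S V (callitic_comp h (callitic_comp g f))
       (callitic_comp (callitic_comp h g) f) (fun=> erefl)).

(* [gmul] is total, but only its values on composable pairs, i.e., pairs [(g, h)]
   with [gdom g = gcod h], are meaningful. *)
HB.mixin Record isGroupoid G := {
  gdom : G -> G;
  gcod : G -> G;
  ginv : G -> G;
  gmul : G -> G -> G;
  gdom_dom : forall g, gdom (gdom g) = gdom g;
  gcod_dom : forall g, gcod (gdom g) = gdom g;
  gdom_cod : forall g, gdom (gcod g) = gcod g;
  gcod_cod : forall g, gcod (gcod g) = gcod g;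
  gdom_mul : forall g h, gdom g = gcod h -> gdom (gmul g h) = gdom h;
  gcod_mul : forall g h, gdom g = gcod h -> gcod (gmul g h) = gcod g;
  gmul_dom : forall g, gmul g (gdom g) = g;
  gmul_cod : forall g, gmul (gcod g) g = g;
  gmulA : forall g h k, gdom g = gcod h -> gdom h = gcod k ->
    gmul g (gmul h k) = gmul (gmul g h) k;
  gdom_inv : forall g, gdom (ginv g) = gcod g;
  gcod_inv : forall g, gcod (ginv g) = gdom g;
  gmulVg : forall g, gmul (ginv g) g = gdom g;
  gmulgV : forall g, gmul g (ginv g) = gcod g
}.

#[short(type="groupoidType")]
HB.structure Definition Groupoid := {G of isGroupoid G}.

Definition identities (G : groupoidType) : set G := [set e : G | gdom e = e].

Definition composable (G : groupoidType) : set (G * G) :=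
  [set p : G * G | gdom p.1 = gcod p.2].

HB.mixin Record isTopologicalGroupoid G of Topological G & isGroupoid G := {
  gmul_continuous :
    {within @composable G, continuous (fun p : G * G => gmul p.1 p.2)};
  ginv_continuous : continuous (@ginv G)
}.

#[short(type="topologicalGroupoidType")]
HB.structure Definition TopologicalGroupoid :=
  {G of isTopologicalGroupoid G & Topological G & isGroupoid G}.

(* [g] is the inverse of the homeomorphism from [U] onto the open set [f @` U];
   its values elsewhere are irrelevant. *)
Definition local_homeomorphism (X Y : topologicalType) (f : X -> Y) : Prop :=
  forall x : X, exists U : set X,
    [/\ open U, U x, open (f @` U), {within U, continuous f} &
      exists g : Y -> X,
        {within f @` U, continuous g} /\ forall u, U u -> g (f u) = u].

Definition locally_compact_boolean_space (X : topologicalType) : Prop :=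
  [/\ (exists2 B : set (set X), basis B & B `<=` clopen),
      locally_compact [set: X] & hausdorff_space X].

HB.mixin Record TopologicalGroupoid_isBoolean G of TopologicalGroupoid G := {
  groupoid_etale : local_homeomorphism (@gdom G);
  identities_boolean :
    locally_compact_boolean_space (set_type (@identities G))
}.

#[short(type="booleanGroupoidType")]
HB.structure Definition BooleanGroupoid :=
  {G of TopologicalGroupoid_isBoolean G & TopologicalGroupoid G}.

Definition is_groupoid_functor (G H : groupoidType) (phi : G -> H) : Prop :=
  [/\ {morph phi : g / gdom g}, {morph phi : g / gcod g} &
      forall g h, gdom g = gcod h -> phi (gmul g h) = gmul (phi g) (phi h)].

Definition is_covering (G H : groupoidType) (phi : G -> H) : Prop :=
  forall e, identities e ->
    set_bij [set g : G | gdom g = e] [set h : H | gdom h = phi e] phi.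

Definition is_coherent (X Y : topologicalType) (f : X -> Y) : Prop :=
  forall U : set Y, open U -> compact U ->
    open (f @^-1` U) /\ compact (f @^-1` U).

Record covering_functor (G H : topologicalGroupoidType) := CoveringFunctor {
  covering_fun :> G -> H;
  covering_fun_functor : is_groupoid_functor covering_fun;
  covering_fun_covering : is_covering covering_fun;
  covering_fun_continuous : continuous covering_fun;
  covering_fun_coherent : is_coherent covering_fun
}.

Lemma covering_functor_eq (G H : topologicalGroupoidType)
  (f g : covering_functor G H) : f =1 g -> f = g.
Proof.
case: f g => [f ? ? ? ?] [g ? ? ? ?] /= /funext fg; subst g.
by congr CoveringFunctor; exact: Prop_irrelevance.
Qed.

Lemma is_groupoid_functor_comp (G H K : groupoidType)
    (psi : H -> K) (phi : G -> H) :
  is_groupoid_functor psi -> is_groupoid_functor phi ->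
  is_groupoid_functor (psi \o phi).
Proof.
move=> [gd gc gm] [fd fc fm]; split=> [g|g|g h gh] /=.
- by rewrite fd gd.
- by rewrite fc gc.
- by rewrite fm // gm // -fd -fc gh.
Qed.

Lemma is_covering_comp (G H K : groupoidType) (psi : H -> K) (phi : G -> H) :
  is_groupoid_functor phi ->
  is_covering psi -> is_covering phi -> is_covering (psi \o phi).
Proof.
move=> [fd _ _] psiC phiC e ie.
have ipe : identities (phi e) by rewrite /identities /= -fd ie.
exact: set_bij_comp (phiC _ ie) (psiC _ ipe).
Qed.

Lemma is_coherent_comp (X Y Z : topologicalType) (g : Y -> Z) (f : X -> Y) :
  is_coherent g -> is_coherent f -> is_coherent (g \o f).
Proof. by move=> gC fC U oU cU; have [] := gC U oU cU; exact: fC. Qed.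

Lemma continuous_comp_fun (X Y Z : topologicalType) (g : Y -> Z) (f : X -> Y) :
  continuous g -> continuous f -> continuous (g \o f).
Proof. by move=> gC fC x; apply: continuous_comp; [exact: fC|exact: gC]. Qed.

Lemma is_groupoid_functor_id (G : groupoidType) : is_groupoid_functor (@idfun G).
Proof. by []. Qed.

Lemma is_covering_id (G : groupoidType) : is_covering (@idfun G).
Proof. by move=> e _; split=> // x /=; exists x. Qed.

Lemma is_coherent_id (X : topologicalType) : is_coherent (@idfun X).
Proof. by []. Qed.

Lemma continuous_idfun (X : topologicalType) : continuous (@idfun X).
Proof. by move=> x; exact: cvg_id. Qed.

Definition covering_id (G : topologicalGroupoidType) : covering_functor G G :=
  CoveringFunctor (is_groupoid_functor_id G) (@is_covering_id G)
    (@continuous_idfun G) (@is_coherent_id G).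

Definition covering_comp (G H K : topologicalGroupoidType)
  (psi : covering_functor H K) (phi : covering_functor G H) :
  covering_functor G K :=
  @CoveringFunctor G K (psi \o phi)
    (is_groupoid_functor_comp
       (covering_fun_functor psi) (covering_fun_functor phi))
    (is_covering_comp (covering_fun_functor phi)
       (covering_fun_covering psi) (covering_fun_covering phi))
    (continuous_comp_fun
       (@covering_fun_continuous _ _ psi) (@covering_fun_continuous _ _ phi))
    (is_coherent_comp
       (covering_fun_coherent psi) (covering_fun_coherent phi)).

Definition boolean_groupoids : category :=
  @Category booleanGroupoidType (fun G H => covering_functor G H)
    (fun G => covering_id G)
    (fun G H K psi phi => covering_comp psi phi)
    (fun G H f => @covering_functor_eq G H (covering_comp (covering_id H) f) f (fun=> erefl))
    (fun G H f => @covering_functor_eq G H (covering_comp f (covering_id G)) f (fun=> erefl))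
    (fun G H K L h g f => @covering_functor_eq G L (covering_comp h (covering_comp g f))
       (covering_comp (covering_comp h g) f) (fun=> erefl)).

(* Main.v *)
From HB Require Import structures.
From mathcomp Require Import all_boot.
From mathcomp Require Import all_classical.
From mathcomp Require Import topology.
Require Import Defs.

Set Implicit Arguments.
Unset Strict Implicit.
Unset Printing Implicit Defensive.

Local Open Scope classical_set_scope.
Local Open Scope group_scope.

(** To a Boolean inverse semigroup [S] corresponds the groupoid of its prime
    filters, with the sets [pf_basic s] of the prime filters that contain [s] as
    a base of the topology; to a Boolean groupoid [G] corresponds the semigroup
    of its compact-open bisections under the product of subsets. Morphisms act
    by inverse image in both directions.

    Prime filters are manageable because a single element of a prime filter [A]
    determines [A] from its domain: for [a] in [A], [x] lies in the domain of
    [A] iff [a * x] lies in [A] ([fdomP]), and [x] lies in the product of [A]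
    and [B] iff [sinv a * x] lies in [B] ([fmulP]). So domains, products and
    lifts of prime filters are preimages of prime filters under left
    translations, which preserve joins, and the groupoid laws are computations
    in [S]. It also follows that the domain map is injective on each
    [pf_basic s], whence the groupoid is etale; relative complements of
    idempotents make its space of identities Hausdorff ([idem_diff]).

    The prime ideal theorem [prime_filter_exists] gives the rest: the sets
    [pf_basic s] are compact ([compact_basic]), [pf_basic s] is contained in
    [pf_basic t] only if [s <= t] ([basic_nle]), and therefore [s |-> pf_basic s]
    is an isomorphism of [S] onto the compact-open bisections of its groupoid;
    surjectivity is a compactness argument, as bisections contained in a common
    bisection are compatible ([basic_cob_surj]).

    In the other direction, the compact-open bisections of [G] form a base
    ([cob_base]), and the point [g] is sent to the prime filter of the
    bisections that contain [g]. Points are separated because the identities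
    form a Hausdorff space, and every prime filter has a cluster point by
    compactness, to which it must belong because bisections have relative
    complements ([point_filter_surj]).

    A callitic morphism is what is needed for inverse images of prime filters to
    be prime filters ([callitic_preim_prime]), and the covering property of a
    functor is what is needed for inverse images of bisections to be bisections
    and to respect products ([covering_preim_cob], [cob_pullbackM]). All finite
    subcovers are taken through the induction principle [compact_elim]. *)

(** * The natural partial order *)

Section NaturalOrderTheory.
Variable S : inverseSemigroupType.
Implicit Types a b c e x y : S.

Lemma idem_conj x e : idempotents e -> idempotents (x * e * sinv x).
Proof.
move=> ie; rewrite /idempotents /=.
have -> : x * e * sinv x * (x * e * sinv x) =
    x * (e * (sinv x * x)) * e * sinv x.
  by rewrite !mulgA.
by rewrite (idemC ie (idemVM x)) !mulgA mulVK -(mulgA x e e) ie.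
Qed.

(** Conjugation moves an idempotent across an element:
    [y * e = (y * e * sinv y) * y]. *)
Lemma nle_left x y : nle x y <-> exists2 e, idempotents e & x = e * y.
Proof.
split=> -[e ie ->].
  exists (y * e * sinv y); first exact: idem_conj.
  by rewrite -!mulgA (idemC ie (idemVM y)) !mulgA mulVK.
exists (sinv y * e * y);
  last by rewrite !mulgA (idemC (idemMV y) ie) -!mulgA (mulgA y) mulVK.
by have := idem_conj (sinv y) ie; rewrite sinvK.
Qed.

Lemma nle_restr x y : nle x y -> x = y * (sinv x * x).
Proof.
move=> [e ie ->]; rewrite sinvM (sinv_idem ie).
have -> : y * (e * sinv y * (y * e)) = y * (e * (sinv y * y)) * e.
  by rewrite !mulgA.
by rewrite (idemC ie (idemVM y)) !mulgA mulVK -mulgA ie.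
Qed.

Lemma nle_anti x y : nle x y -> nle y x -> x = y.
Proof.
move=> [e ie xE] [f jf yE].
have xe : x * e = x by rewrite {1}xE -mulgA ie -xE.
by rewrite xE {1}yE -mulgA (idemC jf ie) mulgA xe -yE.
Qed.

Lemma nle_mulr c x y : nle x y -> nle (x * c) (y * c).
Proof.
by move=> /nle_left[e ie ->]; apply/nle_left; exists e; rewrite ?mulgA.
Qed.

Lemma nle_mull c x y : nle x y -> nle (c * x) (c * y).
Proof. by move=> [e ie ->]; exists e; rewrite ?mulgA. Qed.

Lemma nle_mul a b x y : nle a b -> nle x y -> nle (a * x) (b * y).
Proof. by move=> ab xy; exact: nle_trans (nle_mulr x ab) (nle_mull b xy). Qed.

Lemma nle_sinv x y : nle x y -> nle (sinv x) (sinv y).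
Proof.
by move=> [e ie ->]; apply/nle_left; exists e; rewrite // sinvM (sinv_idem ie).
Qed.

Lemma nle_idem x e : nle x e -> idempotents e -> idempotents x.
Proof. by move=> [f jf ->] ie; exact: idem_mul. Qed.

Lemma idem_mull_nle e x : idempotents e -> nle (e * x) x.
Proof. by move=> ie; apply/nle_left; exists e. Qed.

Lemma idem_mulr_nle e x : idempotents e -> nle (x * e) x.
Proof. by move=> ie; exists e. Qed.

Lemma nle_idem_mul e x y : nle e x -> nle e y -> idempotents e -> nle e (x * y).
Proof. by move=> ex ey ie; rewrite -[X in nle X _]ie; exact: nle_mul. Qed.

Lemma is_join2P a b j : is_join [set a; b] j <->
  [/\ nle a j, nle b j & forall w, nle a w -> nle b w -> nle j w].
Proof.
split=> [[_ ub lub]|[aj bj lub]].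
  split=> [||w aw bw]; [by apply: ub; left|by apply: ub; right|].
  by apply: lub => // _ [->|->].
split=> // [_ [->//|->//]|w _ ubw]; apply: lub; apply: ubw; by [left|right].
Qed.

Lemma join_compatible a b j : is_join [set a; b] j -> compatible a b.
Proof. by move=> /is_join2P[aj bj _]; exact: nle_compatible aj bj. Qed.

End NaturalOrderTheory.

Lemma nle0_eq (S : inverseSemigroup0Type) (x : S) :
  nle x (@szero S) -> x = @szero S.
Proof. by move=> [e _ ->]; rewrite szerol. Qed.

Lemma szero_idem (S : inverseSemigroup0Type) : idempotents (@szero S).
Proof. by rewrite /idempotents /= szerol. Qed.

Section DistributiveTheory.
Variable S : booleanInverseSemigroupType.
Implicit Types a b c e x y : S.

Lemma join_exists a b : compatible a b -> exists j, is_join [set a; b] j.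
Proof. exact: (@boolean_distributive S).1. Qed.

Lemma join_mull c a b j : is_join [set a; b] j ->
  is_join [set c * a; c * b] (c * j).
Proof.
move=> jJ; have cab := join_compatible jJ.
by case: ((@boolean_distributive S).2 _ _ c _ cab jJ).
Qed.

Lemma join_mulr c a b j : is_join [set a; b] j ->
  is_join [set a * c; b * c] (j * c).
Proof.
move=> jJ; have cab := join_compatible jJ.
by case: ((@boolean_distributive S).2 _ _ c _ cab jJ).
Qed.

(** The relative complement [g] of [e] in [f] is taken in the principal ideal of
    [f], which need not contain [e]; hence the detour through [f * e]. *)
Lemma idem_diff e f : idempotents e -> idempotents f ->
  exists g, [/\ idempotents g, e * g = @szero S & is_join [set f * e; g] f].
Proof.
move=> ie jf; have [_ [bot [[bi botP] compl]]] := @boolean_idempotents S.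
have bot0 : bot = @szero S.
  by apply: nle0_eq; apply: botP; exact: szero_idem.
have [f0|fn0] := pselect (f = bot).
  exists (@szero S); split; rewrite ?szeror //; first exact: szero_idem.
  by rewrite f0 bot0 szerol; apply/is_join2P; split=> //; exact: nle_refl.
have [_ [bt [tp [[[bti btf] btP] [[tpi tpf] tpP] cmpl]]]] := compl _ jf fn0.
have tpE : tp = f by apply: nle_anti => //; apply: tpP; split=> //;
  exact: nle_refl.
have btE : bt = @szero S.
  by apply: nle0_eq; apply: btP; split; [exact: szero_idem|exact: nle0].
have fei : idempotents (f * e) by exact: idem_mul.
have [|g [[gi gf] [_ gub glub] [_ _ gglb]]] := cmpl (f * e).
  by split=> //; exact: idem_mulr_nle.
exists g; split=> //.
  have fgE : f * g = g by rewrite {2}(nle_restr gf) (sinv_idem gi) gi.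
  have egi := idem_mul ie gi.
  apply: nle0_eq; rewrite -btE; apply: gglb.
    by split=> //; apply: nle_trans gf; exact: idem_mull_nle.
  move=> _ [->|->]; last exact: idem_mull_nle.
  by rewrite -fgE mulgA (idemC ie jf); exact: idem_mulr_nle.
have [j jJ] := join_exists (nle_compatible (idem_mulr_nle f ie) gf).
suff: f = j by move=> {2}->.
have /is_join2P[j1 j2 jlub] := jJ.
have jf' : nle j f by apply: jlub => //; exact: idem_mulr_nle.
apply: nle_anti => //; rewrite -{1}tpE; apply: glub.
  by split=> //; exact: nle_idem jf' jf.
by move=> _ [->|->].
Qed.

End DistributiveTheory.

(** * Prime filters *)

Record is_prime_filter (S : inverseSemigroup0Type) (A : set S) : Prop :=
  IsPrimeFilter {
  pf_nonempty : A !=set0;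
  pf_up : forall a b, A a -> nle a b -> A b;
  pf_down : forall a b, A a -> A b -> exists c, [/\ A c, nle c a & nle c b];
  pf_zero : ~ A (@szero S);
  pf_prime : forall a b j, is_join [set a; b] j -> A j -> A a \/ A b
}.

Section PrimeFilterOperations.
Variable S : inverseSemigroup0Type.
Implicit Types (A B C : set S) (a b c e x y : S).

Definition fdom A : set S := [set x | exists2 a, A a & nle (sinv a * a) x].

Definition finv A : set S := [set x | A (sinv x)].

(** Defined through inversion, so that facts about codomains are facts about
    domains of inverses. *)
Definition fcod A : set S := fdom (finv A).

Definition fmul A B : set S :=
  [set x | exists a b, [/\ A a, B b & nle (a * b) x]].

Lemma finvK A : finv (finv A) = A.
Proof. by apply/predeqP => x; rewrite /finv /= sinvK. Qed.

Lemma finvM A B : finv (fmul A B) = fmul (finv B) (finv A).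
Proof.
apply/predeqP => x; split=> -[a [b [Aa Bb abx]]]; exists (sinv b), (sinv a).
  by split; rewrite /finv /= ?sinvK //; rewrite -sinvM -[x]sinvK;
    exact: nle_sinv.
by split=> //; rewrite -sinvM; exact: nle_sinv.
Qed.

(** Elements of a filter may be shrunk until they agree, so that any fixed
    element of [A] decides membership in [fdom A]. *)
Lemma fdomP A a x : is_prime_filter A -> A a -> (fdom A x <-> A (a * x)).
Proof.
move=> pA Aa; split=> [[b Ab bx]|Aax].
  have [c [Ac ca cb]] := pf_down pA Aa Ab; apply: (pf_up pA Ac).
  rewrite -[X in nle X _](mulVK c) -mulgA; apply: nle_mul => //.
  by apply: nle_trans bx; apply: nle_mul => //; exact: nle_sinv.
have [c [Ac ca cax]] := pf_down pA Aa Aax; exists c => //.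
apply: (@nle_trans _ (sinv a * (a * x))); first by apply: nle_mul => //;
  exact: nle_sinv.
by rewrite mulgA; exact/idem_mull_nle/idemVM.
Qed.

(** A prime filter is recovered from its domain and any one of its elements. *)
Lemma fdom_sinvP A a x : is_prime_filter A -> A a ->
  (A x <-> fdom A (sinv a * x)).
Proof.
move=> pA Aa; split=> [Ax|/(fdomP _ pA Aa)]; last first.
  by move=> Ax; apply: (pf_up pA Ax); rewrite mulgA; exact/idem_mull_nle/idemMV.
have [c [Ac ca cx]] := pf_down pA Aa Ax; exists c => //.
by apply: nle_mul => //; exact: nle_sinv.
Qed.

Lemma finv_prime A : is_prime_filter A -> is_prime_filter (finv A).
Proof.
move=> pA; split.
- by have [a Aa] := pf_nonempty pA; exists (sinv a); rewrite /finv /= sinvK.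
- by move=> a b; rewrite /finv /= => Aa ab; apply: (pf_up pA Aa);
    exact: nle_sinv.
- move=> a b; rewrite /finv /= => Aa Ab.
  have [c [Ac ca cb]] := pf_down pA Aa Ab; exists (sinv c).
  by split; rewrite /finv /= ?sinvK // -[X in nle _ X]sinvK; exact: nle_sinv.
- by rewrite /finv /= sinv_idem;
    [exact: pf_zero|rewrite /idempotents /= szerol].
move=> a b j /is_join2P[aj bj lub]; apply: (pf_prime pA); apply/is_join2P.
split=> [||w aw bw]; [exact: nle_sinv|exact: nle_sinv|].
by rewrite -[w]sinvK; apply/nle_sinv/lub; rewrite -[X in nle X _]sinvK;
  exact: nle_sinv.
Qed.

Lemma fcodP A a x : is_prime_filter A -> A a -> (fcod A x <-> A (sinv x * a)).
Proof.
move=> pA Aa; have ia : finv A (sinv a) by rewrite /finv /= sinvK.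
by rewrite /fcod (fdomP x (finv_prime pA) ia) /finv /= sinvM sinvK.
Qed.

End PrimeFilterOperations.

Section PrimeFilterGroupoid.
Variable S : booleanInverseSemigroupType.
Implicit Types (A B C : set S) (a b c e x y : S).

(** Domains, products and lifts of prime filters arise in this way: left
    multiplication preserves the order and the joins. *)
Lemma preim_mull_prime A c : is_prime_filter A ->
  (forall x, A x -> A (c * sinv c * x)) -> is_prime_filter [set x | A (c * x)].
Proof.
move=> pA cA; split.
- by have [a Aa] := pf_nonempty pA; exists (sinv c * a); rewrite /= mulgA;
    exact: cA.
- by move=> a b /= Aa ab; apply: (pf_up pA Aa); exact: nle_mull.
- move=> a b /= Aa Ab; have [z [Az za zb]] := pf_down pA Aa Ab.
  exists (sinv c * z); split; first by rewrite mulgA; exact: cA.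
    apply: nle_trans (nle_mull (sinv c) za) _.
    by rewrite mulgA; exact/idem_mull_nle/idemVM.
  apply: nle_trans (nle_mull (sinv c) zb) _.
  by rewrite mulgA; exact/idem_mull_nle/idemVM.
- by rewrite /= szeror; exact: pf_zero.
- by move=> a b j jJ /=; apply: (pf_prime pA); exact: join_mull.
Qed.

Lemma fdom_prime A : is_prime_filter A -> is_prime_filter (fdom A).
Proof.
move=> pA; have [a Aa] := pf_nonempty pA.
have -> : fdom A = [set x | A (a * x)] by apply/predeqP => x; exact: fdomP.
apply: preim_mull_prime => // x Ax; have [c [Ac ca cx]] := pf_down pA Aa Ax.
apply: (pf_up pA Ac); rewrite -[X in nle X _](mulVK c).
by apply: nle_mul => //; apply: nle_mul => //; exact: nle_sinv.
Qed.

Lemma fcod_act A B a y : is_prime_filter A -> is_prime_filter B ->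
  fdom A = fcod B -> A a -> (B (sinv a * a * y) <-> B y).
Proof.
move=> pA pB AB Aa; split=> [By|By].
  by apply: (pf_up pB By); exact/idem_mull_nle/idemVM.
have : fcod B (sinv a * a) by rewrite -AB; exists a => //; exact: nle_refl.
by move=> /(fcodP _ pB By); rewrite sinvM sinvK.
Qed.

(** Since [fdom A = fcod B], the idempotent [sinv a * a] acts as an identity on
    [B], so [fmul A B] is the translate of [B] by any element [a] of [A]. *)
Lemma fmulP A B a x : is_prime_filter A -> is_prime_filter B ->
  fdom A = fcod B -> A a -> (fmul A B x <-> B (sinv a * x)).
Proof.
move=> pA pB AB Aa.
split=> [[b [y [Ab By byx]]]|Bax].
  have [c [Ac ca cb]] := pf_down pA Aa Ab.
  apply: (pf_up pB ((fcod_act y pA pB AB Ac).2 By)).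
  rewrite -mulgA; apply: nle_mul; first exact: nle_sinv.
  by apply: nle_trans byx; exact: nle_mulr.
exists a, (sinv a * x); split=> //.
by rewrite mulgA; exact/idem_mull_nle/idemMV.
Qed.

Lemma fmul_prime A B : is_prime_filter A -> is_prime_filter B ->
  fdom A = fcod B -> is_prime_filter (fmul A B).
Proof.
move=> pA pB AB; have [a Aa] := pf_nonempty pA.
have -> : fmul A B = [set x | B (sinv a * x)] by apply/predeqP => x;
  exact: fmulP.
apply: preim_mull_prime => // x Bx; rewrite sinvK.
by apply/(fcod_act x pA pB AB Aa).
Qed.

Lemma finv_fdom A : is_prime_filter A -> finv (fdom A) = fdom A.
Proof.
have sub B : finv (fdom B) `<=` fdom B.
  move=> x [a Ba ax]; exists a => //.
  by rewrite -[x]sinvK -(sinv_idem (idemVM a)); exact: nle_sinv.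
by move=> pA; apply/seteqP; split=> // x Ax; apply: sub; rewrite /finv /= sinvK.
Qed.

Lemma fdom_dom A : is_prime_filter A -> fdom (fdom A) = fdom A.
Proof.
move=> pA; have [a Aa] := pf_nonempty pA.
have da : fdom A (sinv a * a) by exists a => //; exact: nle_refl.
apply/predeqP => x; rewrite (fdomP x (fdom_prime pA) da) (fdomP _ pA Aa).
by rewrite (fdomP _ pA Aa) !mulgA mulVK.
Qed.

Lemma fcod_dom A : is_prime_filter A -> fcod (fdom A) = fdom A.
Proof. by move=> pA; rewrite /fcod finv_fdom // fdom_dom. Qed.

Lemma fdom_mul A B : is_prime_filter A -> is_prime_filter B ->
  fdom A = fcod B -> fdom (fmul A B) = fdom B.
Proof.
move=> pA pB AB; have [a Aa] := pf_nonempty pA; have [b Bb] := pf_nonempty pB.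
have ABab : fmul A B (a * b) by exists a, b; split=> //; exact: nle_refl.
apply/predeqP => x; rewrite (fdomP x (fmul_prime pA pB AB) ABab).
by rewrite (fmulP _ pA pB AB Aa) !mulgA -mulgA (fcod_act _ pA pB AB Aa) (fdomP x pB Bb).
Qed.

Lemma fcod_mul A B : is_prime_filter A -> is_prime_filter B ->
  fdom A = fcod B -> fcod (fmul A B) = fcod A.
Proof.
move=> pA pB AB; rewrite /fcod finvM fdom_mul //; try exact: finv_prime.
by rewrite /fcod finvK.
Qed.

Lemma fmul_dom A : is_prime_filter A -> fmul A (fdom A) = A.
Proof.
move=> pA; have [a Aa] := pf_nonempty pA; apply/predeqP => x.
rewrite (fmulP x pA (fdom_prime pA) _ Aa) ?fcod_dom //.
by rewrite -(fdom_sinvP x pA Aa).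
Qed.

Lemma fmul_cod A : is_prime_filter A -> fmul (fcod A) A = A.
Proof.
move=> pA; have pV := finv_prime pA.
by rewrite -[LHS]finvK finvM /fcod finv_fdom // fmul_dom // finvK.
Qed.

Lemma fmulA A B C : is_prime_filter A -> is_prime_filter B ->
  is_prime_filter C ->
  fdom A = fcod B -> fdom B = fcod C -> fmul A (fmul B C) = fmul (fmul A B) C.
Proof.
move=> pA pB pC AB BC; have [a Aa] := pf_nonempty pA;
  have [b Bb] := pf_nonempty pB.
have pAB := fmul_prime pA pB AB; have pBC := fmul_prime pB pC BC.
have ABab : fmul A B (a * b) by exists a, b; split=> //; exact: nle_refl.
apply/predeqP => x; rewrite (fmulP x pA pBC _ Aa) ?fcod_mul //.
rewrite (fmulP _ pB pC BC Bb) (fmulP x pAB pC _ ABab) ?fdom_mul //.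
by rewrite sinvM mulgA.
Qed.

Lemma fmulVf A : is_prime_filter A -> fmul (finv A) A = fdom A.
Proof.
move=> pA; have [a Aa] := pf_nonempty pA; have pV := finv_prime pA.
have ia : finv A (sinv a) by rewrite /finv /= sinvK.
by apply/predeqP => x; rewrite (fmulP x pV pA _ ia) // sinvK (fdomP x pA Aa).
Qed.

Lemma fdom_idem A e : is_prime_filter A -> A e -> idempotents e -> fdom A = A.
Proof.
move=> pA Ae ie; apply/predeqP => x; rewrite (fdomP x pA Ae); split=> [Ax|Ax].
  by apply: (pf_up pA Ax); exact: idem_mull_nle.
have [c [Ac ce cx]] := pf_down pA Ae Ax; apply: (pf_up pA Ac).
by apply: nle_idem_mul => //; exact: nle_idem ce ie.
Qed.

(** The prime ideal theorem. A maximal filter [A] disjoint from [I] is prime: if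
    a join [j] of [a] and [b] lies in [A] but [a] and [b] do not, then the
    filters generated by [A] with [a], respectively [b], meet [I], so [I]
    contains [a * e] and [b * e] for some [e = sinv c * c] with [c <= j] in [A];
    hence it contains their join [j * e = c]. *)
Lemma prime_filter_exists (I : set S) (s : S) :
  I (@szero S) -> (forall a b, I b -> nle a b -> I a) ->
  (forall a b j, is_join [set a; b] j -> I a -> I b -> I j) ->
  ~ I s -> exists A, [/\ is_prime_filter A, A s & forall x, A x -> ~ I x].
Proof.
move=> I0 Idown Ijoin nIs.
(* [s] is required only of a nonempty [A], which admits the empty chain. *)
pose P (A : set S) :=
  [/\ forall x, A x -> A s, forall a b, A a -> nle a b -> A b,
  forall a b, A a -> A b -> exists c, [/\ A c, nle c a & nle c b] &
  forall x, A x -> ~ I x].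
have [|M [[Ms Mup Mdown MI] Mmax]] := @Zorn_bigcup _ P.
  move=> F FP Ftot; split.
  - by move=> x [A FA Ax]; exists A => //; have [As _ _ _] := FP _ FA;
      exact: As Ax.
  - by move=> a b [A FA Aa] ab; exists A => //; have [_ Aup _ _] := FP _ FA;
      exact: Aup ab.
  - have down A a b : F A -> A a -> A b ->
        exists c, [/\ (\bigcup_(X in F) X) c, nle c a & nle c b].
      move=> FA Aa Ab; have [_ _ Adown _] := FP _ FA.
      by have [c [Ac ca cb]] := Adown _ _ Aa Ab; exists c; split=> //; exists A.
    move=> a b [A FA Aa] [B FB Bb].
    have [AB|BA] := Ftot _ _ FA FB; first exact: down FB (AB _ Aa) Bb.
    exact: down FA Aa (BA _ Bb).
  - by move=> x [A FA Ax]; have [_ _ _ AI] := FP _ FA; exact: AI.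
have {}Ms : M s.
  apply: contrapT => nMs; apply: (Mmax [set x | nle s x]).
    split; first by move=> x /Ms.
    by move=> /(_ s (nle_refl s)).
  split=> [x _|a b sa ab|a b sa sb|x sx Ix];
    [exact: nle_refl|exact: nle_trans ab| |].
    by exists s; split=> //; exact: nle_refl.
  exact/nIs/(Idown _ _ Ix).
exists M; split=> //; split=> //; first by exists s.
  by move=> /MI; apply.
(* The filter generated by [M] and [a] meets [I]. *)
have meets a j : nle a j -> M j -> ~ M a ->
    exists c, [/\ M c, nle c j & I (a * (sinv c * c))].
  move=> aj Mj nMa; apply: contrapT => nI.
  pose M' := [set z | exists c, [/\ M c, nle c j & nle (a * (sinv c * c)) z]].
  have MM' : M `<=` M'.
    move=> z Mz; have [c [Mc cj cz]] := Mdown _ _ Mj Mz; exists c; split=> //.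
    by apply: nle_trans cz; rewrite [X in nle _ X](nle_restr cj);
      exact: nle_mulr.
  apply: (Mmax M').
    split=> // M'M; apply/nMa/M'M; exists j; split=> //; first exact: nle_refl.
    exact/idem_mulr_nle/idemVM.
  split=> [x _|x y [c [Mc cj cx]] xy|x y [c [Mc cj cx]] [d [Md _ dy]]|x [c [Mc cj cx]] Ix].
  - exact: MM'.
  - by exists c; split=> //; exact: nle_trans xy.
  - have [z [Mz zc zd]] := Mdown _ _ Mc Md; exists (a * (sinv z * z)); split.
    + by exists z; split=> //; [exact: nle_trans cj|exact: nle_refl].
    + by apply: nle_trans cx; apply/nle_mull/nle_mul => //; exact: nle_sinv.
    + by apply: nle_trans dy; apply/nle_mull/nle_mul => //; exact: nle_sinv.
  - by apply: nI; exists c; split=> //; exact: Idown Ix cx.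
move=> a b j jJ Mj; have /is_join2P[aj bj _] := jJ.
have [//|nMa] := pselect (M a); first by left.
right; apply: contrapT => nMb.
have [c [Mc cj Ic]] := meets _ _ aj Mj nMa;
  have [d [Md dj Id]] := meets _ _ bj Mj nMb.
have [z [Mz zc zd]] := Mdown _ _ Mc Md.
have zj := nle_trans zc cj.
apply: (MI z Mz); rewrite (nle_restr zj).
apply: Ijoin (join_mulr (sinv z * z) jJ) _ _.
  by apply: Idown Ic _; apply/nle_mull/nle_mul => //; exact: nle_sinv.
by apply: Idown Id _; apply/nle_mull/nle_mul => //; exact: nle_sinv.
Qed.

End PrimeFilterGroupoid.

(** * Topology *)

Section Topology.
Implicit Types X Y : topologicalType.

(** This replaces every extraction of a finite subcover. If [P K] fails, then the
    sets [A] with [P (K `\` A)] form a proper filter, whose cluster points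
    contradict the local hypothesis. *)
Lemma compact_elim X (K : set X) (P : set X -> Prop) :
  compact K -> P set0 -> (forall A B, A `<=` B -> P B -> P A) ->
  (forall A B, P A -> P B -> P (A `|` B)) ->
  (forall x, K x -> exists U, [/\ open U, U x & P U]) -> P K.
Proof.
move=> cK P0 Pdown PU loc; apply: contrapT => nPK.
pose F : set_system X := [set A | P (K `\` A)].
have FF : ProperFilter F.
  split; first by rewrite /F /= setD0.
  split.
  - by rewrite /F /= setDT.
  - by move=> A B; rewrite /F /= setDIr => PA PB; exact: PU.
  - by move=> A B AB; apply: Pdown => x [Kx nBx]; split=> // /AB.
have FK : F K by rewrite /F /= setDv.
have [x [Kx clx]] := cK F FF FK; have [U [oU Ux PUU]] := loc x Kx.
have [|y [nUy Uy]] := clx (~` U) U _ (open_nbhs_nbhs (conj oU Ux)).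
  by apply: Pdown PUU => y [_]; exact: contrapT.
exact: nUy Uy.
Qed.

Lemma compact_preimage_local X Y (f : X -> Y) (U : set Y) : compact U ->
  (forall y, U y -> exists V, [/\ open V, V y, V `<=` U & compact (f @^-1` V)]) ->
  compact (f @^-1` U).
Proof.
move=> cU loc.
have [K [cK UK KU]] : exists K,
  [/\ compact K, f @^-1` (U `&` U) `<=` K & K `<=` f @^-1` U].
  apply: (@compact_elim _ U (fun A => exists K, [/\ compact K,
    f @^-1` (U `&` A) `<=` K & K `<=` f @^-1` U])) => //.
  - by exists set0; split=> //; [exact: compact0|move=> x []].
  - move=> A B AB [K [cK BK KU]]; exists K; split=> //.
    by move=> x [Ux Ax]; apply: BK; split=> //; exact: AB.
  - move=> A B [K [cK AK KU]] [L [cL BL LU]]; exists (K `|` L); split.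
    + exact: compactU.
    + by move=> x [Ux [Ax|Bx]]; [left; apply: AK|right; apply: BL].
    + by move=> x [/KU|/LU].
  - move=> y /loc[V [oV Vy VU cV]]; exists V; split=> //; exists (f @^-1` V).
    by split=> [|x []|x /VU].
suff : f @^-1` U = K by move=> ->.
by apply/seteqP; split=> // x Ux; apply: UK.
Qed.

Lemma within_continuousP X Y (A : set X) (f : X -> Y) :
  {within A, continuous f} <->
  forall x W, A x -> open W -> W (f x) ->
    exists U, [/\ open U, U x & forall y, U y -> A y -> W (f y)].
Proof.
split=> [/subspace_continuousP fC x W Ax oW Wx|loc].
  have : nbhs x [set y | A y -> W (f y)] :=
    fC x Ax W (open_nbhs_nbhs (conj oW Wx)).
  rewrite nbhsE => -[U [oU Ux] UW].
  by exists U; split=> // y Uy; exact: UW.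
apply/subspace_continuousP => x Ax W; rewrite nbhsE => -[V [oV Vx] VW].
have [U [oU Ux UV]] := loc x V Ax oV Vx.
apply: (@filterS _ (nbhs x) _ U); last exact: open_nbhs_nbhs.
by move=> y Uy Ay; apply: VW; exact: UV.
Qed.

Lemma open_local X (A : set X) :
  (forall x, A x -> exists U, [/\ open U, U x & U `<=` A]) -> open A.
Proof.
move=> loc; rewrite openE => x /loc[U [oU Ux UA]].
by apply: (filterS UA); exact: open_nbhs_nbhs.
Qed.

Lemma open_setX X Y (A : set X) (B : set Y) : open A -> open B ->
  open (A `*` B).
Proof.
rewrite !openE => oA oB [a b] [/= Aa Bb]; exists (A, B) => //=.
by split; [exact: oA|exact: oB].
Qed.

Lemma compact_val X (A : set X) (K : set X) : K `<=` A ->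
  compact K -> compact (val @^-1` K : set (set_type A)).
Proof.
move=> KA cK F FF FK.
have pF : ProperFilter ((val : set_type A -> X) @ F) by exact: fmap_proper_filter.
have [x [Kx clx]] := cK _ pF FK.
exists (exist _ x (mem_set (KA x Kx))); split=> // B N FB.
rewrite nbhsE => -[_ [[O oO <-] Ox] ON].
have FvB : F (val @^-1` (val @` B)) by apply: filterS FB => y By; exists y.
have [_ [[y By <-] Oy]] := clx (val @` B) O FvB (open_nbhs_nbhs (conj oO Ox)).
by exists y; split=> //; exact: ON.
Qed.

(** For the space of identities, this replaces the topology of the subtype by the
    open and the compact sets of the ambient groupoid. *)
Lemma locally_compact_boolean_subspaceP X (A : set X) : open A ->
  locally_compact_boolean_space (set_type A) <->
  (forall x y, A x -> A y -> x <> y -> exists U V,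
    [/\ open U, open V, U x, V y & U `&` V `<=` ~` A]) /\
  (forall x W, A x -> open W -> W x -> exists K,
    [/\ open K, compact K, K x & K `<=` W `&` A]).
Proof.
move=> oA.
have vC : continuous (val : set_type A -> X) by exact: initial_continuous.
split=> [[[B [oB Bx] Bclopen] lc]|[sep base]].
  move=> hd; split=> [x y Ax Ay xy|x W Ax oW Wx].
    have := hd; rewrite open_hausdorff.
    move=> /(_ (exist _ x (mem_set Ax)) (exist _ y (mem_set Ay))) [].
      by apply/eqP => /(congr1 val).
    move=> [U V] /= [/set_mem Ux /set_mem Vy] [[O oO OU] [Q oQ QV] /eqP UV].
    subst U V; exists O, Q; split=> // z [Oz Qz] Az.
    suff : (set0 : set (set_type A)) (exist _ z (mem_set Az)) by [].
    by rewrite -UV.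
  have [C nC [cC clC]] := lc (exist _ x (mem_set Ax)) I.
  have nxC : nbhs (exist _ x (mem_set Ax) : set_type A) C.
    by apply: (@filterS _ (nbhs _) _ [set z | setT z -> C z]) nC => z; exact.
  have nxW : nbhs (exist _ x (mem_set Ax) : set_type A) (val @^-1` W).
    by apply: open_nbhs_nbhs; split=> //; exists W.
  have [b [Bb bx] bCW] := Bx _ _ (filterI nxC nxW).
  exists (val @` b); split.
  - have [O oO <-] := oB _ Bb;
      suff -> : val @` (val @^-1` O : set (set_type A)) = O `&` A.
      exact: openI.
    apply/seteqP; split=> [_ [z Oz <-]|z [Oz Az]]; first by split=> //;
      exact: set_valP.
    by exists (exist _ z (mem_set Az)).
  - apply: continuous_compact; first exact: continuous_subspaceT.
    apply: subclosed_compact cC _; last by move=> z /bCW[].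
    by case: (Bclopen _ Bb).
  - by exists (exist _ x (mem_set Ax)).
  - by move=> _ [z /bCW[_ Wz] <-]; split=> //; exact: set_valP.
have hd : hausdorff_space (set_type A).
  rewrite open_hausdorff => -[x xA] [y yA] xy.
  have [|U [V [oU oV Ux Vy UV]]] := sep x y (set_mem xA) (set_mem yA).
    by move=> e; move/eqP: xy; apply; exact/val_inj.
  exists (val @^-1` U, val @^-1` V); rewrite /= ?inE; first by [].
  split; [by exists U|by exists V|].
  by rewrite -subset0 => z Uz; apply: (UV _ Uz); exact: set_valP.
have Kclopen K : open K -> compact K -> K `<=` A ->
  clopen (val @^-1` K : set (set_type A)).
  move=> oK cK KA; split; first by exists K.
  by apply: compact_closed => //; exact: compact_val.
split=> //.
  exists clopen => //; split; first by move=> U [].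
  move=> [x xA] N; rewrite nbhsE => -[_ [[O oO <-] Ox] ON].
  have [K [oK cK Kx KO]] := base x O (set_mem xA) oO Ox.
  exists (val @^-1` K); first by split=> //; apply: Kclopen => // z /KO[].
  by move=> z /KO[Oz _]; exact: ON.
move=> [x xA] _;
  have [K [oK cK Kx KA]] := base x A (set_mem xA) oA (set_mem xA).
have KA' : K `<=` A by move=> z /KA[].
exists (val @^-1` K); last by split;
  [exact: compact_val|case: (Kclopen _ oK cK KA')].
apply: (@filterS _ (nbhs (exist _ x xA : set_type A)) _ (val @^-1` K));
  first by move=> z ? _.
by apply: open_nbhs_nbhs; split=> //; exists K.
Qed.

End Topology.

(** * The groupoid of prime filters *)

Record prime_filter (S : booleanInverseSemigroupType) := PrimeFilter {
  pf_set :> S -> Prop;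
  pf_setP : is_prime_filter pf_set
}.

HB.instance Definition _ (S : booleanInverseSemigroupType) :=
  gen_eqMixin (prime_filter S).
HB.instance Definition _ (S : booleanInverseSemigroupType) :=
  gen_choiceMixin (prime_filter S).

Section FilterGroupoid.
Variable S : booleanInverseSemigroupType.
Local Notation G := (prime_filter S).
Implicit Types (A B C : G) (a b e s x : S).

Lemma pf_eq A B : pf_set A = pf_set B -> A = B.
Proof.
case: A B => [A pA] [B pB] /= AB; subst B; congr PrimeFilter.
exact: Prop_irrelevance.
Qed.

Lemma pf_eqP A B : (forall x, A x <-> B x) -> A = B.
Proof. by move=> AB; apply/pf_eq/predeqP. Qed.

Lemma pf_mem_nle A a b : nle a b -> A a -> A b.
Proof. by move=> ab Aa; apply: (pf_up (pf_setP A) Aa). Qed.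

Definition pf_dom A : G := PrimeFilter (fdom_prime (pf_setP A)).

Definition pf_inv A : G := PrimeFilter (finv_prime (pf_setP A)).

Definition pf_cod A : G := pf_dom (pf_inv A).

(** On pairs that are not composable the value is arbitrary. *)
Definition pf_mul A B : G :=
  if pselect (fdom (pf_set A) = fcod (pf_set B)) is left AB
  then PrimeFilter (fmul_prime (pf_setP A) (pf_setP B) AB) else A.

Lemma pf_mulE A B : pf_dom A = pf_cod B ->
  pf_set (pf_mul A B) = fmul (pf_set A) (pf_set B).
Proof. by move=> /(congr1 (@pf_set S)) /= AB; rewrite /pf_mul;
  case: pselect. Qed.

Lemma pf_invK A : pf_inv (pf_inv A) = A.
Proof. by apply: pf_eq; exact: finvK. Qed.

Lemma pf_mulVg A : pf_mul (pf_inv A) A = pf_dom A.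
Proof. by apply: pf_eq; rewrite pf_mulE //=; exact: fmulVf (pf_setP A). Qed.

Lemma pf_dom_dom A : pf_dom (pf_dom A) = pf_dom A.
Proof. by apply: pf_eq; exact: fdom_dom (pf_setP A). Qed.

Lemma pf_cod_dom A : pf_cod (pf_dom A) = pf_dom A.
Proof. by apply: pf_eq; exact: fcod_dom (pf_setP A). Qed.

Lemma pf_dom_mul A B : pf_dom A = pf_cod B -> pf_dom (pf_mul A B) = pf_dom B.
Proof.
move=> AB; apply: pf_eq; rewrite /= pf_mulE //; have := congr1 (@pf_set S) AB.
exact: fdom_mul (pf_setP A) (pf_setP B).
Qed.

Lemma pf_cod_mul A B : pf_dom A = pf_cod B -> pf_cod (pf_mul A B) = pf_cod A.
Proof.
move=> AB; apply: pf_eq; rewrite /= pf_mulE //; have := congr1 (@pf_set S) AB.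
exact: fcod_mul (pf_setP A) (pf_setP B).
Qed.

Lemma pf_mul_dom A : pf_mul A (pf_dom A) = A.
Proof.
apply: pf_eq; rewrite pf_mulE ?pf_cod_dom //; exact: fmul_dom (pf_setP A).
Qed.

Lemma pf_mul_cod A : pf_mul (pf_cod A) A = A.
Proof.
apply: pf_eq; rewrite pf_mulE; last exact: pf_dom_dom.
exact: fmul_cod (pf_setP A).
Qed.

Lemma pf_mulA A B C : pf_dom A = pf_cod B -> pf_dom B = pf_cod C ->
  pf_mul A (pf_mul B C) = pf_mul (pf_mul A B) C.
Proof.
move=> AB BC; apply: pf_eq.
rewrite !pf_mulE ?pf_cod_mul ?pf_dom_mul //.
by apply: fmulA; try exact: pf_setP;
  [exact: (congr1 (@pf_set S) AB)|exact: (congr1 (@pf_set S) BC)].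
Qed.

Lemma pf_mulgV A : pf_mul A (pf_inv A) = pf_cod A.
Proof. by rewrite -{1}(pf_invK A) pf_mulVg. Qed.

Lemma pf_dom_cod A : pf_dom (pf_cod A) = pf_cod A.
Proof. exact: pf_dom_dom. Qed.

Lemma pf_cod_cod A : pf_cod (pf_cod A) = pf_cod A.
Proof. exact: pf_cod_dom. Qed.

Lemma pf_cod_inv A : pf_cod (pf_inv A) = pf_dom A.
Proof. by rewrite /pf_cod pf_invK. Qed.

HB.instance Definition _ := @isGroupoid.Build G pf_dom pf_cod pf_inv pf_mul
  pf_dom_dom pf_cod_dom pf_dom_cod pf_cod_cod pf_dom_mul pf_cod_mul pf_mul_dom
  pf_mul_cod pf_mulA (fun=> erefl) pf_cod_inv pf_mulVg pf_mulgV.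

Definition pf_basic s : set G := [set A | A s].

Definition pf_open : set (set G) :=
  [set U | forall A, U A -> exists2 s, A s & pf_basic s `<=` U].

Lemma pf_openT : pf_open setT.
Proof. by move=> A _; have [s As] := pf_nonempty (pf_setP A); exists s. Qed.

Lemma pf_openI : setI_closed pf_open.
Proof.
move=> U V oU oV A [/oU[s As sU] /oV[t At tV]].
have [c [Ac cs ct]] := pf_down (pf_setP A) As At; exists c => // B Bc.
by split; [apply: sU|apply: tV]; apply: pf_mem_nle Bc.
Qed.

Lemma pf_open_bigcup (I : Type) (f : I -> set G) :
  (forall i, pf_open (f i)) -> pf_open (\bigcup_i f i).
Proof.
move=> fo A [i _ /fo[s As sf]]; exists s => // B Bs.
by exists i => //; exact: sf.
Qed.

HB.instance Definition _ :=
  isOpenTopological.Build G pf_openT pf_openI pf_open_bigcup.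

Lemma open_pfP (U : set G) :
  open U <-> forall A, U A -> exists2 s, A s & pf_basic s `<=` U.
Proof. by []. Qed.

Lemma open_basic s : open (pf_basic s).
Proof. by move=> A As; exists s. Qed.

(** For a filter [F] on the space, the [x] whose basic set has its complement in
    [F] form an ideal, and a prime filter that avoids it is a cluster point. *)
Lemma compact_basic s : compact (pf_basic s).
Proof.
move=> F FF Fs; pose I : set S := [set x | F (~` pf_basic x)].
have [||||A [pA As AI]] := @prime_filter_exists _ I s.
- by apply: filterS filterT => A _; exact: pf_zero (pf_setP A).
- move=> a b Ib ab; apply: filterS Ib => A nAb Aa.
  by apply: nAb; exact: pf_mem_nle Aa.
- move=> a b j jJ Ia Ib; apply: filterS (filterI Ia Ib) => A [nAa nAb] Aj.
  by case: (pf_prime (pf_setP A) jJ Aj).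
- move=> Is; have : F (pf_basic s `&` ~` pf_basic s) by exact: filterI.
  by rewrite setICr; exact: filter_not_empty.
exists (PrimeFilter pA); split=> // X N FX.
rewrite nbhsE => -[U [oU UA] UN]; have [t At tU] := (open_pfP U).1 oU _ UA.
apply: contrapT => nXN; apply: (AI t At); apply: filterS FX => B XB Bt.
by apply: nXN; exists B; split=> //; apply/UN/tU.
Qed.

Lemma pf_comp_mem A B a x : gdom A = gcod B -> A a ->
  (gmul A B : G) x <-> B (sinv a * x).
Proof.
move=> AB Aa; rewrite [X in X x](pf_mulE AB).
by apply: fmulP => //; try exact: pf_setP; exact: (congr1 (@pf_set S) AB).
Qed.

Lemma pf_dom_mem A a x : A a -> (gdom A : G) x <-> A (a * x).
Proof. by move=> Aa; exact: fdomP (pf_setP A) Aa. Qed.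

Lemma pf_dom_sinv_mem A a x : A a -> A x <-> (gdom A : G) (sinv a * x).
Proof. by move=> Aa; exact: fdom_sinvP (pf_setP A) Aa. Qed.

Lemma pf_mul_continuous :
  {within @composable G, continuous (fun p : G * G => gmul p.1 p.2)}.
Proof.
apply/within_continuousP => -[A B] W /= AB oW WAB.
have [x xAB xW] := (open_pfP W).1 oW _ WAB.
have [a Aa] := pf_nonempty (pf_setP A).
exists (pf_basic a `*` pf_basic (sinv a * x)); split.
- by apply: open_setX; exact: open_basic.
- by split=> //=; exact/(pf_comp_mem x AB Aa).
- by move=> [A' B'] /= [A'a B'x] AB'; apply: xW; exact/(pf_comp_mem x AB' A'a).
Qed.

Lemma pf_inv_continuous : continuous (@ginv G).
Proof.
apply/continuousP => U /open_pfP oU; apply/open_pfP => A /= /oU[s As sU].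
by exists (sinv s) => // B Bs; apply: sU; exact: Bs.
Qed.

HB.instance Definition _ :=
  isTopologicalGroupoid.Build G pf_mul_continuous pf_inv_continuous.

(** The element of [pf_basic a] with domain [B], which exists when [B] contains
    [sinv a * a]; otherwise a default value. *)
Definition pf_lift a B : G :=
  if pselect (is_prime_filter [set x | B (sinv a * x)]) is left pf
  then PrimeFilter pf else B.

Lemma pf_lift_mem a B x : gdom B = B -> B (sinv a * a) ->
  pf_lift a B x <-> B (sinv a * x).
Proof.
move=> BB Ba; rewrite /pf_lift; case: pselect => //; case.
apply: preim_mull_prime (pf_setP B) _ => y By; rewrite sinvK.
by apply/(pf_dom_mem y Ba); rewrite BB.
Qed.

Lemma pf_lift_basic a B : gdom B = B -> B (sinv a * a) -> pf_lift a B a.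
Proof. by move=> BB Ba; apply/pf_lift_mem. Qed.

Lemma pf_dom_lift a B : gdom B = B -> B (sinv a * a) -> gdom (pf_lift a B) = B.
Proof.
move=> BB Ba; apply: pf_eqP => x.
rewrite (pf_dom_mem x (pf_lift_basic BB Ba)) pf_lift_mem // mulgA.
by rewrite -(pf_dom_mem x Ba) BB.
Qed.

Lemma pf_lift_dom a A : A a -> pf_lift a (gdom A) = A.
Proof.
move=> Aa; have da : (gdom A : G) (sinv a * a) by exists a => //;
  exact: nle_refl.
apply: pf_eqP => x; rewrite pf_lift_mem //; last exact: gdom_dom.
exact: iff_sym (pf_dom_sinv_mem x Aa).
Qed.

Lemma pf_basic_inj a A B : A a -> B a -> gdom A = gdom B -> A = B.
Proof. by move=> Aa Ba AB; rewrite -(pf_lift_dom Aa) AB pf_lift_dom. Qed.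

Lemma pf_identityP A : identities A <-> exists2 e, idempotents e & A e.
Proof.
split=> [AA|[e ie Ae]]; last by apply: pf_eq;
  exact: fdom_idem (pf_setP A) Ae ie.
have [a Aa] := pf_nonempty (pf_setP A).
exists (sinv a * a); first exact: idemVM.
by rewrite -[A]AA; exists a => //; exact: nle_refl.
Qed.

Lemma pf_dom_continuous : continuous (@gdom G).
Proof.
apply/continuousP => U /open_pfP oU;
  apply/open_pfP => A /= /oU[s [a Aa as_] sU].
by exists a => // B Ba; apply: sU; exists a.
Qed.

Lemma image_dom_basic a : @gdom G @` pf_basic a = pf_basic (sinv a * a).
Proof.
apply/seteqP; split=> [_ [A Aa <-]|B Ba]; first by exists a => //;
  exact: nle_refl.
have BB : gdom B = B by apply/pf_identityP; exists (sinv a * a) => //;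
  exact: idemVM.
by exists (pf_lift a B); [exact: pf_lift_basic|exact: pf_dom_lift].
Qed.

Lemma pf_etale : local_homeomorphism (@gdom G).
Proof.
move=> A; have [a Aa] := pf_nonempty (pf_setP A); exists (pf_basic a);
  split=> //.
- exact: open_basic.
- by rewrite image_dom_basic; exact: open_basic.
- exact: continuous_subspaceT pf_dom_continuous.
exists (pf_lift a); split; last by move=> B Ba; exact: pf_lift_dom.
rewrite image_dom_basic; apply/within_continuousP => B W Ba oW WB.
have idB C : pf_basic (sinv a * a) C -> gdom C = C.
  by move=> Ca; apply/pf_identityP; exists (sinv a * a) => //; exact: idemVM.
have [x Bx xW] := (open_pfP W).1 oW _ WB.
exists (pf_basic (sinv a * x)); split; first exact: open_basic.
  by apply/pf_lift_mem => //; exact: idB.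
by move=> C Cx Ca; apply: xW; apply/pf_lift_mem => //; exact: idB.
Qed.

Lemma pf_identities_open : open (@identities G).
Proof.
apply/open_pfP => A /pf_identityP[e ie Ae]; exists e => // B Be.
by apply/pf_identityP; exists e.
Qed.

(** If [x] distinguishes the identities [A] and [B], then so does an idempotent
    [c] of [A] below [x]; any idempotent of [B] splits along [c], and primality
    puts the part disjoint from [c] into [B]. *)
Lemma pf_separated A B x : identities A -> identities B -> A x -> ~ B x ->
  exists c g, [/\ A c, B g & pf_basic c `&` pf_basic g = set0].
Proof.
move=> /pf_identityP[e ie Ae] /pf_identityP[f jf Bf] Ax nBx.
have [c [Ac ce cx]] := pf_down (pf_setP A) Ae Ax.
have ic := nle_idem ce ie.
have [g [ig cg0 gJ]] := idem_diff ic jf.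
exists c, g; split=> //.
  have [Bfc|//] := pf_prime (pf_setP B) gJ Bf.
  by case: nBx; apply: pf_mem_nle Bfc; exact: nle_trans (idem_mull_nle c jf) cx.
rewrite -subset0 => C [/= Cc Cg];
  have [z [Cz zc zg]] := pf_down (pf_setP C) Cc Cg.
apply: (pf_zero (pf_setP C)); apply: pf_mem_nle Cz.
by rewrite -cg0; apply: nle_idem_mul => //; exact: nle_idem zc ic.
Qed.

Lemma pf_identities_boolean :
  locally_compact_boolean_space (set_type (@identities G)).
Proof.
apply/(locally_compact_boolean_subspaceP pf_identities_open).
split=> [A B iA iB AB|A W iA oW WA].
  have [x ABx] : exists x, ~ (A x <-> B x).
    by apply/existsNP => AB'; apply: AB; exact: pf_eqP.
  have [Ax|nAx] := pselect (A x).
    have nBx : ~ B x by move=> Bx; apply: ABx.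
    have [c [g [Ac Bg cg]]] := pf_separated iA iB Ax nBx.
    exists (pf_basic c), (pf_basic g); split=> //; try exact: open_basic.
    by rewrite cg.
  have Bx : B x by apply: contrapT => nBx; apply: ABx.
  have [c [g [Bc Ag cg]]] := pf_separated iB iA Bx nAx.
  exists (pf_basic g), (pf_basic c); split=> //; try exact: open_basic.
  by rewrite setIC cg.
have [s As sW] := (open_pfP W).1 oW _ WA.
have [e ie Ae] := (pf_identityP A).1 iA.
have [c [Ac cs ce]] := pf_down (pf_setP A) As Ae.
exists (pf_basic c); split=> //; [exact: open_basic|exact: compact_basic|].
move=> B Bc; split; first by apply: sW; apply: pf_mem_nle Bc.
by apply/pf_identityP; exists c => //; exact: nle_idem ce ie.
Qed.

HB.instance Definition _ :=
  TopologicalGroupoid_isBoolean.Build G pf_etale pf_identities_boolean.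

End FilterGroupoid.

(** * Boolean groupoids *)

Section GroupoidTheory.
Variable G : groupoidType.
Implicit Types g h k e : G.

Lemma gmulKg g h : gdom g = gcod h -> gmul (ginv g) (gmul g h) = h.
Proof.
by move=> gh; rewrite gmulA ?gdom_inv // gmulVg gh gmul_cod.
Qed.

Lemma gmulgK g h : gdom g = gcod h -> gmul (gmul g h) (ginv h) = g.
Proof.
by move=> gh; rewrite -gmulA ?gcod_inv // gmulgV -gh gmul_dom.
Qed.

Lemma ginvK g : ginv (ginv g) = g.
Proof.
have {2}<- : gmul (ginv (ginv g)) (gmul (ginv g) g) = g.
  by apply: gmulKg; rewrite gdom_inv.
by rewrite gmulVg -gcod_inv -gdom_inv gmul_dom.
Qed.

Lemma gmulVKg g h : gcod g = gcod h -> gmul g (gmul (ginv g) h) = h.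
Proof. by move=> gh; rewrite -{1}(ginvK g) gmulKg // gdom_inv. Qed.

Lemma gmulgVK g h : gdom g = gdom h -> gmul (gmul g (ginv h)) h = g.
Proof. by move=> gh; rewrite -{2}(ginvK h) gmulgK // gcod_inv. Qed.

Lemma identities_dom g : identities (gdom g).
Proof. exact: gdom_dom. Qed.

Lemma identities_cod g : identities (gcod g).
Proof. exact: gdom_cod. Qed.

Lemma gcod_id e : identities e -> gcod e = e.
Proof. by move=> ie; rewrite -{1}ie gcod_dom ie. Qed.

Lemma gmul_idl e g : identities e -> gdom e = gcod g -> gmul e g = g.
Proof. by move=> ie eg; rewrite -[e]ie eg gmul_cod. Qed.

Lemma gmul_idr e g : identities e -> gdom g = gcod e -> gmul g e = g.
Proof. by move=> ie; rewrite gcod_id // => <-; rewrite gmul_dom. Qed.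

Lemma gmulV_eq g h : gdom g = gdom h -> identities (gmul g (ginv h)) -> g = h.
Proof.
move=> gh ie; rewrite -(gmulgVK gh) gmul_idl // gdom_mul ?gcod_inv //.
exact: gdom_inv.
Qed.

Lemma gmulVg_eq g h : gcod g = gcod h -> identities (gmul (ginv g) h) -> g = h.
Proof.
move=> gh ie; rewrite -(gmulVKg gh) gmul_idr // gcod_mul ?gdom_inv //.
by rewrite gcod_inv.
Qed.

Definition gset_mul (U V : set G) : set G :=
  [set k | exists g h, [/\ U g, V h, gdom g = gcod h & k = gmul g h]].

Definition gset_inv (U : set G) : set G := [set g | U (ginv g)].

Definition bisection (U : set G) : Prop :=
  (forall g h, U g -> U h -> gdom g = gdom h -> g = h) /\
  (forall g h, U g -> U h -> gcod g = gcod h -> g = h).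

Lemma bisection_sub U V : U `<=` V -> bisection V -> bisection U.
Proof. by move=> UV [Vd Vc]; split=> g h /UV Vg /UV Vh;
  [exact: Vd|exact: Vc]. Qed.

Lemma bisection_identities : bisection (@identities G).
Proof.
split=> g h ig ih; first by rewrite ig ih.
by rewrite !gcod_id.
Qed.

Lemma bisection_mul U V : bisection U -> bisection V ->
  bisection (gset_mul U V).
Proof.
move=> [Ud Uc] [Vd Vc];
  split=> _ _ [g [h [Ug Vh gh ->]]] [g' [h' [Ug' Vh' gh' ->]]].
  rewrite !gdom_mul // => /(Vd _ _ Vh Vh') E; subst h'.
  by congr gmul; apply: Ud => //; rewrite gh gh'.
rewrite !gcod_mul // => /(Uc _ _ Ug Ug') E; subst g'.
by congr gmul; apply: Vc => //; rewrite -gh -gh'.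
Qed.

Lemma bisection_inv U : bisection U -> bisection (gset_inv U).
Proof.
move=> [Ud Uc]; split=> g h Ug Uh gh; apply: (can_inj ginvK).
  by apply: Uc => //; rewrite !gcod_inv.
by apply: Ud => //; rewrite !gdom_inv.
Qed.

Lemma bisectionU U V : bisection U -> bisection V ->
  (forall g h, U g -> V h -> gdom g = gdom h -> g = h) ->
  (forall g h, U g -> V h -> gcod g = gcod h -> g = h) -> bisection (U `|` V).
Proof.
move=> [Ud Uc] [Vd Vc] UVd UVc; split=> g h.
  move=> [Ug|Vg] [Uh|Vh] gh; [exact: Ud|exact: UVd| |exact: Vd].
  by apply/esym/UVd.
move=> [Ug|Vg] [Uh|Vh] gh; [exact: Uc|exact: UVc| |exact: Vc].
by apply/esym/UVc.
Qed.

Lemma gset_mulA U V W : gset_mul U (gset_mul V W) = gset_mul (gset_mul U V) W.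
Proof.
apply/seteqP; split=> k.
  move=> [g [_ [Ug [h [l [Vh Wl hl ->]]] + ->]]].
  rewrite gcod_mul // => gh; exists (gmul g h), l; split=> //.
  - by exists g, h.
  - by rewrite gdom_mul.
  - by rewrite gmulA.
move=> [_ [l [[g [h [Ug Vh gh ->]]] Wl + ->]]].
rewrite gdom_mul // => hl; exists g, (gmul h l); split=> //.
- by exists h, l.
- by rewrite gcod_mul.
- by rewrite gmulA.
Qed.

Lemma gset_invK U : gset_inv (gset_inv U) = U.
Proof. by apply/predeqP => g; rewrite /gset_inv /= ginvK. Qed.

Lemma gset_mulVK U : bisection U -> gset_mul (gset_mul U (gset_inv U)) U = U.
Proof.
move=> [Ud Uc]; apply/seteqP; split=> [k|k Uk]; last first.
  exists (gmul k (ginv k)), k; split=> //.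
  - by exists k, (ginv k); split=> //; rewrite /gset_inv /= ?ginvK ?gcod_inv.
  - by rewrite gdom_mul ?gcod_inv // gdom_inv.
  - by rewrite gmulgV gmul_cod.
move=> [_ [w [[g [h [Ug Uh gh ->]]] Uw + ->]]].
rewrite gdom_mul // => hw.
have -> : h = ginv g by rewrite (Ud _ _ Ug Uh) ?ginvK // gdom_inv.
rewrite gmulgV; suff -> : w = g by rewrite gmul_cod.
by rewrite (Ud _ _ Ug Uh) ?gdom_inv //; apply: Uc => //; rewrite gcod_inv.
Qed.

(** If [ginv g = u * h * w] with [u] and [w] in the bisection [U], then [u] and
    [w] have the codomain and the domain of [ginv g], hence are equal to it; so
    [h = g]. *)
Lemma gset_inv_unique U V : bisection U -> gset_mul (gset_mul U V) U = U ->
  gset_inv U `<=` V.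
Proof.
move=> [Ud Uc] UVU g Ug; have := Ug; rewrite /gset_inv /= -{1}UVU.
move=> [_ [w [[u [h [Uu Vh uh ->]]] Uw + E]]]; rewrite gdom_mul // => hw.
have wE : w = ginv g.
  by apply: Ud => //; rewrite E gdom_mul ?gdom_mul.
have uE : u = ginv g.
  by apply: Uc => //; rewrite E gcod_mul ?gdom_mul ?gcod_mul.
suff -> : g = h by [].
subst w u; rewrite -(gmulKg uh) ginvK.
have -> : gmul (ginv g) h = gcod (ginv g).
  by rewrite -gmulgV {2}E gmulgK // gdom_mul.
by rewrite gcod_inv gmul_dom.
Qed.

Lemma gset_mul_identities U V : U `<=` @identities G -> V `<=` @identities G ->
  gset_mul U V = U `&` V.
Proof.
move=> iU iV; apply/seteqP; split=> [_ [g [h [Ug Vh gh ->]]]|g [Ug Vg]].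
  have E : g = h by rewrite -(iU _ Ug) gh gcod_id //; exact: iV.
  by subst h; rewrite gmul_idl //; exact: iU.
have ig := iU _ Ug.
by exists g, g; rewrite gmul_idl // ig gcod_id.
Qed.

Lemma gset_mul_idem U : bisection U -> gset_mul U U = U -> U `<=` @identities G.
Proof.
move=> [Ud Uc] UU k Uk; have := Uk; rewrite -{1}UU => -[g [h [Ug Uh gh E]]].
have hE : h = k by apply: Ud => //; rewrite E gdom_mul.
have gE : g = k by apply: Uc => //; rewrite E gcod_mul.
by subst g h; have := gmulKg gh; rewrite -E gmulVg.
Qed.

End GroupoidTheory.

Section EtaleTheory.
Variable G : booleanGroupoidType.
Implicit Types (g h k e : G) (U V W K L : set G).

Lemma gdom_continuous : continuous (@gdom G).
Proof.
apply/continuousP => W oW; apply: open_local => g Wg.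
have [U [oU Ug _ /within_continuousP Uc _]] := @groupoid_etale G g.
have [V [oV Vg VW]] := Uc g W Ug oW Wg; exists (U `&` V); split=> //.
  exact: openI.
by move=> h [Uh Vh]; exact: VW.
Qed.

Lemma gdom_locally_inj g : exists U, [/\ open U, U g &
  forall h k, U h -> U k -> gdom h = gdom k -> h = k].
Proof.
have [U [oU Ug _ _ [s [_ sK]]]] := @groupoid_etale G g; exists U; split=> //.
by move=> h k Uh Uk hk; rewrite -(sK h Uh) hk sK.
Qed.

Lemma gdom_open U : open U -> open (@gdom G @` U).
Proof.
move=> oU; apply: open_local => _ [g Ug <-].
have [V [oV Vg odV _ [s [/within_continuousP sc sK]]]] := @groupoid_etale G g.
have [||W [oW Wg WU]] := sc (gdom g) U _ oU; first by exists g.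
  by rewrite sK.
exists (W `&` @gdom G @` V); split; [exact: openI|by split=> //; exists g|].
move=> k [Wk [h Vh hk]]; exists h => //.
by rewrite -(sK h Vh) hk; apply: WU => //; exists h.
Qed.

Lemma gcod_continuous : continuous (@gcod G).
Proof.
have -> : @gcod G = @gdom G \o @ginv G by apply/funext => g;
  rewrite /= gdom_inv.
by move=> g; apply: continuous_comp;
  [exact: ginv_continuous|exact: gdom_continuous].
Qed.

Lemma gset_inv_open U : open U -> open (gset_inv U).
Proof. by move: U; apply/continuousP; exact: ginv_continuous. Qed.

Lemma gmul_near g h W : gdom g = gcod h -> open W -> W (gmul g h) ->
  exists U V, [/\ open U, open V, U g, V h &
    forall g' h', U g' -> V h' -> gdom g' = gcod h' -> W (gmul g' h')].
Proof.
move=> gh oW Wgh; have /within_continuousP mc := @gmul_continuous G.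
have [N [oN Ngh NW]] := mc (g, h) W gh oW Wgh.
have : nbhs (g, h) N by exact: open_nbhs_nbhs.
move=> [[A B] [/=]]; rewrite !nbhsE => -[U [oU Ug] UA] [V [oV Vh] VB] ABN.
exists U, V; split=> // g' h' Ug' Vh' gh'.
by apply: (NW (g', h')) => //; apply: ABN; split; [exact: UA|exact: VB].
Qed.

Lemma identities_open : open (@identities G).
Proof.
suff -> : @identities G = @gdom G @` setT by apply: gdom_open; exact: openT.
by apply/seteqP; split=> [e <-|_ [g _ <-]]; [exists e|exact: gdom_dom].
Qed.

(** An element [k] near the product of [g] and [h] has the domain of some [h']
    near [h], and then it is the product of [k * ginv h'] and [h']. *)
Lemma gset_mul_open U V : open U -> open V -> open (gset_mul U V).
Proof.
move=> oU oV; apply: open_local => _ [g [h [Ug Vh gh ->]]].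
have [||A [B [oA oB Agh Bh AB]]] := @gmul_near (gmul g h) (ginv h) U _ oU.
- by rewrite gdom_mul // gcod_inv.
- by rewrite gmulgK.
pose V' := V `&` gset_inv B.
have oV' : open V' by apply: openI => //; exact: gset_inv_open.
exists (A `&` @gdom G @^-1` (@gdom G @` V')); split.
- apply: openI => //; move: (gdom_open oV'); move: (_ @` _).
  by apply/continuousP; exact: gdom_continuous.
- by split=> //; exists h => //; rewrite gdom_mul.
move=> k [Ak [h' [Vh' Bh'] hk]]; exists (gmul k (ginv h')), h'; split=> //.
- by apply: AB => //; rewrite gcod_inv.
- by rewrite gdom_mul ?gdom_inv // gcod_inv.
- by rewrite gmulgVK.
Qed.

(** Compact sets of identities are closed in the Hausdorff space of identities,
    but in general not in the groupoid. *)
Lemma identities_diff_open K : compact K -> K `<=` @identities G ->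
  open (@identities G `\` K).
Proof.
have [sep _] := (locally_compact_boolean_subspaceP identities_open).1 (@identities_boolean G).
move=> cK Ki; apply: open_local => e [ie nKe].
have [V [oV Ve VK]] : exists V,
  [/\ open V, V e & V `&` K `<=` ~` @identities G].
  apply: (@compact_elim _ K (fun A => exists V, [/\ open V, V e &
      V `&` A `<=` ~` @identities G])) => //.
  - by exists setT; split=> // [|x []]; [exact: openT|move=> _ []].
  - by move=> A B AB [V [oV Ve VB]]; exists V; split=> // x [Vx /AB Bx];
      exact: VB.
  - move=> A B [V [oV Ve VA]] [W [oW We WB]]; exists (V `&` W); split=> //.
      exact: openI.
    by move=> x [[Vx Wx] [Ax|Bx]]; [exact: VA|exact: WB].
  - move=> f Kf; have [|V [W [oV oW Ve Wf VW]]] := sep e f ie (Ki _ Kf).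
      by move=> ef; apply: nKe; rewrite ef.
    by exists W; split=> //; exists V.
exists (V `&` @identities G); split=> //; first exact: openI oV identities_open.
by move=> x [Vx ix]; split=> // Kx; exact: VK (conj Vx Kx) ix.
Qed.

Lemma closed_preimage_identities (f : G -> G) K : continuous f ->
  (forall g, identities (f g)) -> compact K -> K `<=` @identities G ->
  closed (f @^-1` K).
Proof.
move=> fC fi cK Ki; rewrite -openC.
suff -> : ~` (f @^-1` K) = f @^-1` (@identities G `\` K).
  by move: (identities_diff_open cK Ki); move: (_ `\` _); exact/continuousP.
by apply/seteqP; split=> [g nKg|g []].
Qed.

(** An open set on which the domain map is injective is homeomorphic to its
    image. *)
Lemma compact_gdom_image U : open U ->
  (forall g h, U g -> U h -> gdom g = gdom h -> g = h) ->
  compact (@gdom G @` U) -> compact U.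
Proof.
move=> oU Ud cU F FF FU.
have FdU : F (@gdom G @^-1` (@gdom G @` U)).
  by apply: filterS FU => g Ug; exists g.
have [_ [[g Ug <-] clg]] := cU (@gdom G @ F) _ FdU.
exists g; split=> // B N FB; rewrite nbhsE => -[W [oW Wg] WN].
have FdB : F (@gdom G @^-1` (@gdom G @` (B `&` U))).
  by apply: filterS (filterI FB FU) => h Bh; exists h.
have odW : open (@gdom G @` (W `&` U)) by apply: gdom_open; exact: openI.
have [|_ [[h [Bh Uh] <-] [k [Wk Uk] kh]]] := clg _ (@gdom G @` (W `&` U)) FdB.
  by apply: open_nbhs_nbhs; split=> //; exists g.
by exists h; split=> //; apply: WN; rewrite -(Ud _ _ Uk Uh kh).
Qed.

Record is_compact_open_bisection U : Prop := IsCompactOpenBisection {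
  cob_open : open U;
  cob_compact : compact U;
  cob_bisection : bisection U
}.

Lemma compact_gdom U : compact U -> compact (@gdom G @` U).
Proof.
by move=> cU; apply: continuous_compact => //;
  exact/continuous_subspaceT/gdom_continuous.
Qed.

(** The product is homeomorphic to its set of domains, which is also the set of
    domains of a relatively closed part of [V]. *)
Lemma is_cob_mul U V : is_compact_open_bisection U ->
  is_compact_open_bisection V -> is_compact_open_bisection (gset_mul U V).
Proof.
move=> [oU cU bU] [oV cV bV]; have bUV := bisection_mul bU bV.
have oUV := gset_mul_open oU oV; split=> //;
  apply: (compact_gdom_image oUV bUV.1).
suff -> : @gdom G @` gset_mul U V =
    @gdom G @` (V `&` @gcod G @^-1` (@gdom G @` U)).
  apply: compact_gdom; apply: compact_closedI => //.
  apply: closed_preimage_identities.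
  - exact: gcod_continuous.
  - exact: identities_cod.
  - exact: compact_gdom.
  - by move=> _ [g _ <-]; exact: identities_dom.
apply/seteqP; split=> [_ [_ [g [h [Ug Vh gh ->]]] <-]|_ [h [Vh [g Ug gh]] <-]].
  by exists h; [split=> //; exists g|rewrite gdom_mul].
by exists (gmul g h); [exists g, h|rewrite gdom_mul].
Qed.

Lemma is_cob_inv U : is_compact_open_bisection U ->
  is_compact_open_bisection (gset_inv U).
Proof.
move=> [oU cU bU]; split; [exact: gset_inv_open| |exact: bisection_inv].
suff -> : gset_inv U = @ginv G @` U.
  by apply: continuous_compact => //;
    exact/continuous_subspaceT/ginv_continuous.
apply/seteqP; split=> [g Ug|_ [g Ug <-]]; first by exists (ginv g);
  rewrite ?ginvK.
by rewrite /gset_inv /= ginvK.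
Qed.

Lemma is_cob_sub U V : open U -> compact U -> U `<=` V ->
  is_compact_open_bisection V -> is_compact_open_bisection U.
Proof. by move=> oU cU UV [_ _ bV]; split=> //; exact: bisection_sub bV. Qed.

Lemma is_cob_identities U : open U -> compact U -> U `<=` @identities G ->
  is_compact_open_bisection U.
Proof. by move=> oU cU Ui; split=> //;
  exact: bisection_sub (@bisection_identities G). Qed.

(** [V] is closed in [U], although not in the groupoid, because [U] is
    homeomorphic to its set of domains. *)
Lemma is_cob_diff U V : is_compact_open_bisection U -> open V -> compact V ->
  V `<=` U -> is_compact_open_bisection (U `\` V).
Proof.
move=> pU oV cV VU; have [oU cU [Ud _]] := pU; apply: is_cob_sub pU => //.
- suff -> : U `\` V = U `&` @gdom G @^-1` (@identities G `\` @gdom G @` V).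
    apply: openI => //; have : open (@identities G `\` @gdom G @` V).
      apply: identities_diff_open; first exact: compact_gdom.
      by move=> _ [g _ <-]; exact: identities_dom.
    by move: (_ `\` _); apply/continuousP; exact: gdom_continuous.
  apply/seteqP; split=> g [Ug nVg]; split=> //.
    split; first exact: identities_dom.
    by move=> [h Vh hg]; apply: nVg; rewrite -(Ud h g) //; exact: VU.
  by move=> Vg; case: nVg => _; apply; exists g.
- by rewrite setDE; apply: compact_closedI => //; exact: open_closedC.
Qed.

Lemma cob_base g W : open W -> W g ->
  exists U, [/\ is_compact_open_bisection U, U g & U `<=` W].
Proof.
have [_ base] := (locally_compact_boolean_subspaceP identities_open).1 (@identities_boolean G).
move=> oW Wg; have [A [oA Ag Ad]] := gdom_locally_inj g.
have [B [oB Bg Bd]] := gdom_locally_inj (ginv g).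
pose V := W `&` A `&` gset_inv B.
have oV : open V by apply: openI; [exact: openI|exact: gset_inv_open].
have [|K [oK cK Kg KV]] :=
  base (gdom g) (@gdom G @` V) (identities_dom g) (gdom_open oV).
  by exists g.
have bV : bisection V.
  split=> h k [[_ Ah] Bh] [[_ Ak] Bk] hk; first exact: Ad.
  by apply: (can_inj (@ginvK G)); apply: Bd => //; rewrite !gdom_inv.
exists (V `&` @gdom G @^-1` K); split=> [|//|h [[[]]]//].
have sV : V `&` @gdom G @^-1` K `<=` V by move=> h [].
have oU : open (V `&` @gdom G @^-1` K).
  by apply: openI => //; move: oK; move: (K); apply/continuousP;
    exact: gdom_continuous.
split=> //; last exact: bisection_sub bV.
apply: compact_gdom_image => //; first exact: (bisection_sub sV bV).1.
suff -> : @gdom G @` (V `&` @gdom G @^-1` K) = K by [].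
apply/seteqP; split=> [_ [h [_ Kh] <-]//|e Ke].
by have [[h Vh he] _] := KV e Ke; exists h => //; split=> //=; rewrite he.
Qed.

End EtaleTheory.

(** * The semigroup of compact-open bisections *)

Record cobisection (G : booleanGroupoidType) := Cobisection {
  cob_set :> G -> Prop;
  cob_setP : is_compact_open_bisection cob_set
}.

HB.instance Definition _ (G : booleanGroupoidType) :=
  gen_eqMixin (cobisection G).
HB.instance Definition _ (G : booleanGroupoidType) :=
  gen_choiceMixin (cobisection G).

Section CobisectionSemigroup.
Variable G : booleanGroupoidType.
Local Notation T := (cobisection G).
Implicit Types (U V W C : T) (g h k e : G).

Lemma cob_eq U V : cob_set U = cob_set V -> U = V.
Proof.
case: U V => [U pU] [V pV] /= UV; subst V; congr Cobisection.
exact: Prop_irrelevance.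
Qed.

Definition cob_mul U V : T :=
  Cobisection (is_cob_mul (cob_setP U) (cob_setP V)).

Definition cob_inv U : T := Cobisection (is_cob_inv (cob_setP U)).

Lemma cob_mulA : associative cob_mul.
Proof. by move=> U V W; apply: cob_eq; exact: gset_mulA. Qed.

HB.instance Definition _ := isSemigroup.Build T cob_mulA.

Lemma cob_setM U V : cob_set (U * V) = gset_mul (cob_set U) (cob_set V).
Proof. by []. Qed.

Lemma cob_invK U : cob_inv (cob_inv U) = U.
Proof. by apply: cob_eq; exact: gset_invK. Qed.

Lemma cob_mulVK U : U * cob_inv U * U = U.
Proof. by apply: cob_eq; exact: gset_mulVK (cob_bisection (cob_setP U)). Qed.

Lemma cob_mulKV U : cob_inv U * U * cob_inv U = cob_inv U.
Proof. by rewrite -{2}(cob_invK U) cob_mulVK. Qed.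

Lemma cob_inv_unique U V : U * V * U = U -> V * U * V = V -> V = cob_inv U.
Proof.
move=> UVU VUV; apply/cob_eq/seteqP; split; last first.
  apply: gset_inv_unique; first exact: (cob_bisection (cob_setP U)).
  exact: (congr1 (@cob_set G) UVU).
have sub : gset_inv (cob_set V) `<=` cob_set U.
  apply: gset_inv_unique; first exact: (cob_bisection (cob_setP V)).
  exact: (congr1 (@cob_set G) VUV).
by move=> g Vg; apply: sub; rewrite /gset_inv /= ginvK.
Qed.

HB.instance Definition _ :=
  Semigroup_isInverse.Build T cob_mulVK cob_mulKV cob_inv_unique.

Lemma is_cob0 : is_compact_open_bisection (set0 : set G).
Proof. by apply: is_cob_identities => //; [exact: open0|exact: compact0]. Qed.

Lemma cob_mul0l U : Cobisection is_cob0 * U = Cobisection is_cob0.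
Proof. by apply: cob_eq; apply/predeqP => k; split=> // -[g [h []]]. Qed.

Lemma cob_mul0r U : U * Cobisection is_cob0 = Cobisection is_cob0.
Proof. by apply: cob_eq; apply/predeqP => k; split=> // -[g [h []]]. Qed.

HB.instance Definition _ := Semigroup_hasZero.Build T cob_mul0l cob_mul0r.

Lemma cob_idemP U : idempotents U <-> cob_set U `<=` @identities G.
Proof.
split=> [/(congr1 (@cob_set G))|iU].
  exact: gset_mul_idem (cob_bisection (cob_setP U)).
by apply: cob_eq; rewrite cob_setM gset_mul_identities // setIid.
Qed.

Lemma cob_nleP U V : nle U V <-> cob_set U `<=` cob_set V.
Proof.
split=> [[E /cob_idemP iE ->] _ [g [e [Vg Ee ge ->]]]|UV].
  by rewrite gmul_idr //; exact: iE.
exists (cob_inv U * U); first exact: idemVM.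
apply: cob_eq; rewrite !cob_setM; apply/seteqP; split=> [g Ug|].
  exists g, (gdom g); rewrite gcod_dom gmul_dom; split=> //; first exact: UV.
  exists (ginv g), g; rewrite gdom_inv gmulVg; split=> //.
  by rewrite /= /gset_inv /= ginvK.
move=> _ [g [_ [Vg [h [k [Uh Uk hk ->]]] + ->]]]; rewrite gcod_mul // => gh.
have -> : g = ginv h.
  apply: (cob_bisection (cob_setP V)).1 => //; first exact: UV.
  by rewrite gdom_inv.
by rewrite gmulKg.
Qed.

Lemma cob_union_exists U V : bisection (cob_set U `|` cob_set V) ->
  exists W, cob_set W = cob_set U `|` cob_set V.
Proof.
move=> bUV; have [oU cU _] := cob_setP U; have [oV cV _] := cob_setP V.
have pUV : is_compact_open_bisection (cob_set U `|` cob_set V).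
  by split=> //; [exact: openU|exact: compactU].
by exists (Cobisection pUV).
Qed.

Lemma cob_joinP U V W :
  is_join [set U; V] W <-> cob_set W = cob_set U `|` cob_set V.
Proof.
rewrite is_join2P; split=> [[/cob_nleP UW /cob_nleP VW lub]|WE]; last first.
  split=> [||X /cob_nleP UX /cob_nleP VX]; apply/cob_nleP; rewrite WE.
  - by move=> g; left.
  - by move=> g; right.
  - by move=> g [/UX|/VX].
have bUV : bisection (cob_set U `|` cob_set V).
  by apply: bisection_sub (cob_bisection (cob_setP W)) => g [/UW|/VW].
have [X XE] := cob_union_exists bUV.
apply/seteqP; split; last by move=> g [/UW|/VW].
rewrite -XE; apply/cob_nleP; apply: lub; apply/cob_nleP; rewrite XE => g;
  by [left|right].
Qed.

(** For [g] in [U] and [h] in [V] with the same domain, [g * ginv h] belongs to a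
    set of identities. *)
Lemma cob_compatible_bisection U V :
  compatible U V -> bisection (cob_set U `|` cob_set V).
Proof.
move=> [/cob_idemP iVU /cob_idemP iUV].
apply: bisectionU; try exact: cob_bisection (cob_setP _).
  move=> g h Ug Vh gh; apply: gmulV_eq => //; apply: iUV.
  exists g, (ginv h); rewrite gcod_inv; split=> //.
  by rewrite /sinv /= /gset_inv /= ginvK.
move=> g h Ug Vh gh; apply: gmulVg_eq => //; apply: iVU.
exists (ginv g), h; rewrite gdom_inv; split=> //.
by rewrite /sinv /= /gset_inv /= ginvK.
Qed.

Lemma cob_distributive : is_distributive T.
Proof.
split=> [U V /cob_compatible_bisection /cob_union_exists[W WE]|U V C W _].
  by exists W; apply/cob_joinP.
move=> /cob_joinP WE; split; apply/cob_joinP; rewrite !cob_setM WE.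
  apply/seteqP; split=> k.
    by move=> [g [h [Cg [Uh|Vh] gh ->]]]; [left|right]; exists g, h.
  by move=> [] [g [h [Cg Uh gh ->]]]; exists g, h; split=> //; [left|right].
apply/seteqP; split=> k.
  by move=> [g [h [[Ug|Vg] Ch gh ->]]]; [left|right]; exists g, h.
by move=> [] [g [h [Ug Ch gh ->]]]; exists g, h; split=> //; [left|right].
Qed.

Lemma cob_setI U V : idempotents U -> idempotents V ->
  cob_set (U * V) = cob_set U `&` cob_set V.
Proof. by move=> /cob_idemP iU /cob_idemP iV;
  rewrite cob_setM gset_mul_identities. Qed.

Lemma cob_idem_union U V : idempotents U -> idempotents V ->
  exists W, cob_set W = cob_set U `|` cob_set V.
Proof.
move=> /cob_idemP iU /cob_idemP iV; apply: cob_union_exists.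
by apply: bisection_sub (@bisection_identities G) => g [/iU|/iV].
Qed.

(** Stated for an ideal of idempotents, so as to apply to all the idempotents
    and to the principal ideals alike. *)
Lemma cob_idem_lattice (D : set G) : D `<=` @identities G ->
  is_distributive_lattice (@nle T) [set U : T | cob_set U `<=` D].
Proof.
move=> iD; have iT U : cob_set U `<=` D -> idempotents U.
  by move=> UD; apply/cob_idemP; exact: subset_trans UD iD.
split.
  split=> [U _|U V _ _|U V W _ _ _];
    [exact: nle_refl|exact: nle_anti|exact: nle_trans].
pose join U V : T := xget U [set W | cob_set W = cob_set U `|` cob_set V].
have joinE U V : cob_set U `<=` D -> cob_set V `<=` D ->
    cob_set (join U V) = cob_set U `|` cob_set V.
  by move=> /iT iU /iT iV; exact: (xgetPex U (cob_idem_union iU iV)).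
have meetE U V : cob_set U `<=` D -> cob_set V `<=` D ->
    cob_set (U * V) = cob_set U `&` cob_set V.
  by move=> /iT iU /iT iV; exact: cob_setI.
exists join, (fun U V => U * V); split=> [U V UD VD|U V UD VD|U V W UD VD WD].
- split; first by rewrite /= joinE // => g [/UD|/VD].
    by move=> _ [->|->]; apply/cob_nleP; rewrite joinE.
  move=> W WD ubW; apply/cob_nleP; rewrite joinE //.
  by move=> g [Ug|Vg]; [apply: ((cob_nleP U W).1 (ubW _ (or_introl erefl)))
                       |apply: ((cob_nleP V W).1 (ubW _ (or_intror erefl)))].
- split; first by move=> g; rewrite meetE // => -[/UD].
    by move=> _ [->|->]; apply/cob_nleP; rewrite meetE.
  move=> W WD lbW; apply/cob_nleP; rewrite meetE // => g Wg; split.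
    exact: ((cob_nleP W U).1 (lbW _ (or_introl erefl))).
  exact: ((cob_nleP W V).1 (lbW _ (or_intror erefl))).
- apply: cob_eq; rewrite meetE ?joinE ?meetE //; first exact: setIUr.
  + by move=> g [/UD].
  + by move=> g [/UD].
  + by move=> g [/VD|/WD].
Qed.

Lemma cob_generalized_boolean :
  is_generalized_boolean_algebra (@nle T) (@idempotents T).
Proof.
have idE : @idempotents T = [set U : T | cob_set U `<=` @identities G].
  by apply/predeqP => U; exact: cob_idemP.
split; first by rewrite idE; exact: cob_idem_lattice.
exists (@szero T); split; first by split=> [|U _];
  [exact: szero_idem|exact: nle0].
move=> U iU _.
have ideal : [set x | idempotents x /\ nle x U] = [set V : T | cob_set V `<=` cob_set U].
  apply/predeqP => V; split=> [[_ /cob_nleP//]|/cob_nleP VU]; split=> //.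
  exact: nle_idem VU iU.
have iU' := (cob_idemP U).1 iU.
rewrite ideal; split; first exact: cob_idem_lattice.
exists (@szero T), U; split.
- by split=> [g []|V _]; exact: nle0.
- by split=> // V /cob_nleP.
move=> V VU; have [oV cV _] := cob_setP V.
pose W := Cobisection (is_cob_diff (cob_setP U) oV cV VU).
have WU : cob_set W `<=` cob_set U by move=> g [].
exists W; split=> //.
  split=> // [_ [->|->]|X _ ubX]; try exact/cob_nleP.
  apply/cob_nleP => g Ug; have [Vg|nVg] := pselect (V g).
    exact: ((cob_nleP V X).1 (ubX _ (or_introl erefl))).
  exact: ((cob_nleP W X).1 (ubX _ (or_intror erefl))).
split=> [g []|X _|X _ lbX]; first exact: nle0.
apply/cob_nleP => g Xg.
have [_ []] := (cob_nleP X W).1 (lbX _ (or_intror erefl)) g Xg.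
exact: ((cob_nleP X V).1 (lbX _ (or_introl erefl))).
Qed.

HB.instance Definition _ :=
  InverseSemigroup0_isBoolean.Build T cob_distributive cob_generalized_boolean.

End CobisectionSemigroup.

(** * The functor from semigroups to groupoids *)

Lemma morph_sinv (S T : inverseSemigroupType) (f : S -> T) :
  {morph f : a b / a * b} -> {morph f : a / sinv a}.
Proof. by move=> fM a; apply: sinv_unique; rewrite -!fM ?mulVK ?mulKV. Qed.

Lemma prime_filter_seq_join (S : booleanInverseSemigroupType) (A : set S)
    (xs : seq S) (s : S) :
  is_prime_filter A -> is_join [set` xs] s -> A s -> exists2 x, x \in xs & A x.
Proof.
move=> pA; elim: xs s => [|x xs IH] s [_ ub lub] As.
  case: (pf_zero pA); suff <- : s = szero by [].
  by apply: nle0_eq; apply: lub.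
have [||j [jJ js _]] := @finite_join S S idfun xs s erefl.
- by [].
- by move=> y yxs; apply: ub; rewrite /= inE yxs orbT.
have sJ : is_join [set x; j] s.
  apply/is_join2P; split=> [|//|w xw jw]; first by apply: ub;
    rewrite /= inE eqxx.
  apply: lub => // y; rewrite /= inE => /predU1P[->//|yxs].
  by apply: nle_trans jw; case: jJ => _ + _; exact.
have [Ax|Aj] := pf_prime pA sJ As; first by exists x; rewrite ?inE ?eqxx.
by have [y yxs Ay] := IH j jJ Aj; exists y; rewrite // inE yxs orbT.
Qed.

Section FilterPullback.
Variables (S T : booleanInverseSemigroupType) (theta : callitic S T).
Implicit Types (A B : prime_filter T).

(** Properness makes the inverse image nonempty, weak preservation of meets makes
    it directed, and preservation of joins makes it prime. *)
Lemma callitic_preim_prime (A : set T) :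
  is_prime_filter A -> is_prime_filter (theta @^-1` A).
Proof.
have [tM t0 tJ] := callitic_morphism theta => pA; split.
- have [t At] := pf_nonempty pA; have [ts [tsJ tsP]] := callitic_proper theta t.
  have [x /tsP[s xs] Ax] := prime_filter_seq_join pA tsJ At.
  by exists s; apply: (pf_up pA Ax).
- by move=> a b /= Aa ab; apply: (pf_up pA Aa); exact: nle_homo.
- move=> a b /= Aa Ab; have [t [At ta tb]] := pf_down pA Aa Ab.
  have [c [ca cb tc]] := callitic_wmp ta tb; exists c; split=> //.
  exact: (pf_up pA At).
- by rewrite /= t0; exact: pf_zero.
- move=> a b j jJ /=; apply: (pf_prime pA).
  exact: tJ (join_compatible jJ) jJ.
Qed.

Definition pf_pullback A : prime_filter S :=
  PrimeFilter (callitic_preim_prime (pf_setP A)).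

Lemma pf_pullback_dom A : pf_pullback (gdom A) = gdom (pf_pullback A).
Proof.
have [tM _ _] := callitic_morphism theta.
have [s As] := pf_nonempty (pf_setP (pf_pullback A)).
apply: pf_eqP => x; rewrite (pf_dom_mem x As).
by rewrite [X in X <-> _](pf_dom_mem (theta x) As) -tM.
Qed.

Lemma pf_pullback_inv A : pf_pullback (ginv A) = ginv (pf_pullback A).
Proof.
have [tM _ _] := callitic_morphism theta.
by apply: pf_eqP => x; rewrite /= /finv /= morph_sinv.
Qed.

Lemma pf_pullback_cod A : pf_pullback (gcod A) = gcod (pf_pullback A).
Proof. by rewrite -!gdom_inv pf_pullback_dom pf_pullback_inv. Qed.

Lemma pf_pullback_mul A B : gdom A = gcod B ->
  pf_pullback (gmul A B) = gmul (pf_pullback A) (pf_pullback B).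
Proof.
have [tM _ _] := callitic_morphism theta => AB.
have AB' : gdom (pf_pullback A) = gcod (pf_pullback B).
  by rewrite -pf_pullback_dom AB pf_pullback_cod.
have [s As] := pf_nonempty (pf_setP (pf_pullback A)).
apply: pf_eqP => x; rewrite (pf_comp_mem x AB' As).
by rewrite [X in X <-> _](pf_comp_mem (theta x) AB As) -morph_sinv // -tM.
Qed.

Lemma pf_pullback_functor : is_groupoid_functor pf_pullback.
Proof.
split; [exact: pf_pullback_dom|exact: pf_pullback_cod|exact: pf_pullback_mul].
Qed.

(** The lift of [H] at [E] is the prime filter with domain [E] that contains
    [theta s], for any [s] in [H]; a prime filter is determined by such data. *)
Lemma pf_pullback_covering : is_covering pf_pullback.
Proof.
have [tM _ _] := callitic_morphism theta.
move=> E iE; split.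
- by move=> A /= <-; rewrite pf_pullback_dom.
- move=> A B /set_mem/= AE /set_mem/= BE AB.
  have [s As] := pf_nonempty (pf_setP (pf_pullback A)).
  have Bs : pf_pullback B s by rewrite -AB.
  by apply: (@pf_basic_inj T (theta s) A B As Bs); rewrite AE BE.
move=> H /= HE; have [s Hs] := pf_nonempty (pf_setP H).
have Es : E (sinv (theta s) * theta s).
  rewrite -morph_sinv // -tM; have : pf_pullback E (sinv s * s).
    by rewrite -HE; exists s => //; exact: nle_refl.
  by [].
exists (pf_lift (theta s) E); first exact: pf_dom_lift.
have ps : pf_pullback (pf_lift (theta s) E) s by exact: pf_lift_basic.
by apply: (pf_basic_inj ps Hs); rewrite -pf_pullback_dom pf_dom_lift.
Qed.

Lemma pf_pullback_continuous : continuous pf_pullback.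
Proof.
apply/continuousP => U /open_pfP oU; apply/open_pfP => A /= /oU[s As sU].
by exists (theta s) => // B Bs; exact: sU.
Qed.

Lemma pf_pullback_coherent : is_coherent pf_pullback.
Proof.
move=> U oU cU; split.
  by move: oU; move: (U); apply/continuousP; exact: pf_pullback_continuous.
apply: compact_preimage_local => // A /(open_pfP U).1 - /(_ oU)[s As sU].
exists (pf_basic s); split=> //; first exact: open_basic.
exact: (@compact_basic T (theta s)).
Qed.

Definition pullback_functor : covering_functor (prime_filter T) (prime_filter S) :=
  CoveringFunctor pf_pullback_functor pf_pullback_covering
    pf_pullback_continuous pf_pullback_coherent.

End FilterPullback.

Definition filter_functor :
  functor boolean_inverse_semigroups (opposite boolean_groupoids).
Proof.
exists (fun S : boolean_inverse_semigroups => prime_filter S : booleanGroupoidType)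
  (fun S T theta => @pullback_functor S T theta).
  by move=> S; apply: covering_functor_eq => A; exact: pf_eq.
by move=> S T U psi theta; apply: covering_functor_eq => A; exact: pf_eq.
Defined.

(** * The functor from groupoids to semigroups *)

Section CobisectionPullback.
Variables (G H : booleanGroupoidType) (phi : covering_functor G H).
Implicit Types (U V W : cobisection H) (g h k : G).

Lemma covering_dom g : phi (gdom g) = gdom (phi g).
Proof. by have [fd _ _] := covering_fun_functor phi. Qed.

Lemma covering_cod g : phi (gcod g) = gcod (phi g).
Proof. by have [_ fc _] := covering_fun_functor phi. Qed.

Lemma covering_mul g h :
  gdom g = gcod h -> phi (gmul g h) = gmul (phi g) (phi h).
Proof. by have [_ _ fm] := covering_fun_functor phi; exact: fm. Qed.

Lemma covering_inv g : phi (ginv g) = ginv (phi g).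
Proof.
have E : gmul (phi (ginv g)) (phi g) = gdom (phi g).
  by rewrite -covering_mul ?gdom_inv // gmulVg covering_dom.
have gg : gdom (phi (ginv g)) = gcod (phi g).
  by rewrite -covering_dom gdom_inv covering_cod.
by rewrite -(gmulgK gg) E -gcod_inv gmul_cod.
Qed.

Lemma covering_inj g h : gdom g = gdom h -> phi g = phi h -> g = h.
Proof.
move=> gh; have [_ inj _] := covering_fun_covering phi (identities_dom g).
by apply: inj; apply/mem_set => /=.
Qed.

Lemma covering_lift g (k : H) : gdom k = phi (gdom g) ->
  exists2 h, gdom h = gdom g & phi h = k.
Proof.
have [_ _ surj] := covering_fun_covering phi (identities_dom g).
by move=> /surj[h hg hk]; exists h.
Qed.

Lemma covering_preim_cob (U : set H) : is_compact_open_bisection U ->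
  is_compact_open_bisection (phi @^-1` U).
Proof.
move=> [oU cU [Ud Uc]]; have [oP cP] := @covering_fun_coherent _ _ phi U oU cU;
  split=> //.
split=> g h Ug Uh gh.
  by apply: covering_inj => //; apply: Ud => //; rewrite -!covering_dom gh.
apply: (can_inj (@ginvK G)); apply: covering_inj; rewrite ?gdom_inv //.
by rewrite !covering_inv; congr ginv; apply: Uc => //;
  rewrite -!covering_cod gh.
Qed.

Definition cob_pullback U : cobisection G :=
  Cobisection (covering_preim_cob (cob_setP U)).

(** If [phi k = u * v], then [v] lifts to some [h] with the domain of [k], and
    [k = (k * ginv h) * h]. *)
Lemma cob_pullbackM : {morph cob_pullback : U V / U * V}.
Proof.
move=> U V; apply/cob_eq/seteqP; split=> k; last first.
  move=> [g [h [Ug Vh gh ->]]]; exists (phi g), (phi h).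
  by rewrite covering_mul // -covering_dom -covering_cod gh.
move=> [u [v [Uu Vv uv kE]]].
have [|h hk hv] := @covering_lift k v;
  first by rewrite covering_dom kE gdom_mul.
subst v; exists (gmul k (ginv h)), h; split=> //.
- rewrite /= /preimage /= covering_mul ?gcod_inv // covering_inv kE gmulgK //.
- by rewrite gdom_mul ?gcod_inv // gdom_inv.
- by rewrite gmulgVK.
Qed.

Lemma cob_pullback_morphism : is_morphism cob_pullback.
Proof.
split; [exact: cob_pullbackM|by apply: cob_eq|].
by move=> U V W _ /cob_joinP WE; apply/cob_joinP; rewrite /= WE.
Qed.

(** The intersection of [U] and [V] is open but perhaps not compact; the image of
    the compact set [W] is covered by finitely many of its compact-open parts. *)
Lemma cob_pullback_wmp : is_weakly_meet_preserving cob_pullback.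
Proof.
move=> W U V /cob_nleP WU /cob_nleP WV.
have [oW cW _] := cob_setP W; have [oU _ _] := cob_setP U;
  have [oV _ _] := cob_setP V.
suff [C [CU CV WC]] : exists C,
  [/\ nle C U, nle C V & cob_set W `<=` phi @^-1` C].
  by exists C; split=> //; exact/cob_nleP.
apply: (@compact_elim _ _ (fun A => exists C, [/\ nle C U, nle C V & A `<=` phi @^-1` C]) cW).
- by exists szero; split=> //; exact: nle0.
- by move=> A B AB [C [CU CV BC]]; exists C; split=> // g /AB; exact: BC.
- move=> A B [C [CU CV AC]] [D [DU DV BD]].
  have [E EJ] := join_exists (nle_compatible CU DU); exists E.
  have /is_join2P[_ _ lub] := EJ; split; [exact: lub|exact: lub|].
  by move/cob_joinP: EJ => ->; move=> g [/AC|/BD]; [left|right].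
move=> g Wg; have [||C [pC Cg CUV]] :=
  @cob_base _ (phi g) (cob_set U `&` cob_set V).
- exact: openI.
- by split; [exact: WU|exact: WV].
exists (phi @^-1` C); split=> //.
  by move: (cob_open pC); move: (C); apply/continuousP;
    exact: covering_fun_continuous.
by exists (Cobisection pC); split=> //; apply/cob_nleP => h /CUV[].
Qed.

(** Each point [g] of [W] has a compact-open bisection inside both [W] and the
    inverse image of a bisection around [phi g]; finitely many of them cover [W]. *)
Lemma cob_pullback_proper : is_proper cob_pullback.
Proof.
move=> W; have [oW cW _] := cob_setP W.
pose below (X : cobisection G) := nle X W /\ exists U, nle X (cob_pullback U).
suff [ts [tsP Wts]] : exists ts : seq (cobisection G),
    (forall X, X \in ts -> below X) /\
    cob_set W `<=` [set g | exists2 X : cobisection G, X \in ts & X g].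
  exists ts; split; last by move=> X /tsP[].
  split=> // [X /= /tsP[]//|V _ ubV]; apply/cob_nleP => g /Wts[X Xts Xg].
  by move: g Xg; apply/cob_nleP; exact: ubV.
apply: (@compact_elim _ _ (fun A => exists ts : seq (cobisection G),
    (forall X, X \in ts -> below X) /\
    A `<=` [set g | exists2 X : cobisection G, X \in ts & X g]) cW).
- by exists [::]; split=> // g [].
- by move=> A B AB [ts [tsP Bts]]; exists ts; split=> // g /AB; exact: Bts.
- move=> A B [ts [tsP Ats]] [us [usP Bus]]; exists (ts ++ us); split=> [X|g].
    by rewrite mem_cat => /orP[/tsP|/usP].
  by move=> [/Ats|/Bus] [X Xs Xg]; exists X => //; rewrite mem_cat Xs ?orbT.
move=> g Wg; have [U [pU Ug _]] := cob_base (@openT H) (I : setT (phi g)).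
have oPU : open (phi @^-1` U).
  by move: (cob_open pU); move: (U); apply/continuousP;
    exact: covering_fun_continuous.
have [X [pX Xg XWU]] := cob_base (openI oW oPU) (conj Wg Ug).
exists X; split=> //; first exact: cob_open pX.
exists [:: Cobisection pX]; split=> [Y|h Xh]; last by exists (Cobisection pX);
  rewrite ?inE.
rewrite inE => /eqP->; split; first by apply/cob_nleP => h /XWU[].
by exists (Cobisection pU); apply/cob_nleP => h /XWU[].
Qed.

Definition pullback_callitic : callitic (cobisection H) (cobisection G) :=
  Callitic cob_pullback_morphism cob_pullback_proper cob_pullback_wmp.

End CobisectionPullback.

Definition cobisection_functor :
  functor (opposite boolean_groupoids) boolean_inverse_semigroups.
Proof.
exists (fun G : opposite boolean_groupoids => cobisection G : booleanInverseSemigroupType)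
  (fun G H phi => @pullback_callitic H G phi).
  by move=> G; apply: callitic_eq => U; exact: cob_eq.
by move=> G H K psi phi; apply: callitic_eq => U; exact: cob_eq.
Defined.

(** * Unit and counit *)

Section BijectiveHomomorphism.
Variables (S T : inverseSemigroup0Type) (f : S -> T) (g : T -> S).
Hypotheses (fK : cancel f g) (gK : cancel g f) (fM : {morph f : a b / a * b}).

Lemma bij_morph_inv : {morph g : a b / a * b}.
Proof. by move=> a b; rewrite -{1}(gK a) -{1}(gK b) -fM fK. Qed.

Lemma bij_nle a b : nle (f a) (f b) <-> nle a b.
Proof.
split=> [[e ie E]|[e ie ->]].
  exists (g e); first by rewrite /idempotents /= -bij_morph_inv ie.
  by apply: (can_inj fK); rewrite fM gK.
by exists (f e); rewrite ?fM // /idempotents /= -fM ie.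
Qed.

Lemma bij_is_morphism : is_morphism f.
Proof.
split=> //.
  have <- : f (szero * g szero) = szero by rewrite fM gK szeror.
  by rewrite szerol.
move=> a b j _ /is_join2P[aj bj lub]; apply/is_join2P.
split=> [||w]; [exact/bij_nle|exact/bij_nle|].
by rewrite -(gK w) => /bij_nle aw /bij_nle bw; apply/bij_nle; exact: lub.
Qed.

Lemma bij_is_proper : is_proper f.
Proof.
move=> t; exists [:: t]; split=> [|x _]; last by exists (g x); rewrite gK;
  exact: nle_refl.
split=> // [x /=|w _]; first by rewrite inE => /eqP->; exact: nle_refl.
by apply; rewrite /= inE.
Qed.

Lemma bij_is_weakly_meet_preserving : is_weakly_meet_preserving f.
Proof.
move=> t a b; rewrite -(gK t) => /bij_nle ta /bij_nle tb.
by exists (g t); split=> //; exact: nle_refl.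
Qed.

Definition callitic_of_bij : callitic S T :=
  Callitic bij_is_morphism bij_is_proper bij_is_weakly_meet_preserving.

End BijectiveHomomorphism.

Section Unit.
Variable S : booleanInverseSemigroupType.
Implicit Types (a b s t x : S).
Local Notation P := (prime_filter S).

Lemma bisection_basic s : bisection (@pf_basic S s).
Proof.
split=> A B As Bs AB; first exact: pf_basic_inj As Bs AB.
apply: (can_inj (@ginvK P)).
apply: (@pf_basic_inj S (sinv s)); rewrite ?gdom_inv //.
  by rewrite /= /finv /= sinvK.
by rewrite /= /finv /= sinvK.
Qed.

Definition basic_cob s : cobisection P := Cobisection (IsCompactOpenBisection
  (@open_basic S s) (@compact_basic S s) (bisection_basic s)).

(** A prime filter [A] that contains [s * t] is the product of [A * ginv C] and
    [C], where [C] is the prime filter with the domain of [A] that contains [t]. *)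
Lemma basic_cobM : {morph basic_cob : s t / s * t}.
Proof.
move=> s t; apply/cob_eq/seteqP; split=> [A Ast|_ [A [B [As Bt AB ->]]]];
  last first.
  have : fmul (pf_set A) (pf_set B) (s * t) by exists s, t; split=> //;
    exact: nle_refl.
  by rewrite -(pf_mulE AB).
have dA : (gdom A : P) (sinv (s * t) * (s * t)) by exists (s * t) => //;
  exact: nle_refl.
have dAt : (gdom A : P) (sinv t * t).
  apply: pf_mem_nle dA; rewrite sinvM -!mulgA; apply: nle_mull.
  by rewrite mulgA; exact/idem_mull_nle/idemVM.
pose C := pf_lift t (gdom A).
have dC : gdom C = gdom A by apply: pf_dom_lift => //; exact: gdom_dom.
have AC : gdom A = gcod (ginv C) by rewrite gcod_inv.
exists (gmul A (ginv C)), C; split.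
- apply/(pf_comp_mem s AC Ast).
  rewrite /= /finv /= sinvM sinvK; apply/pf_lift_mem => //;
    first exact: gdom_dom.
  by move: dA; rewrite sinvM !mulgA.
- by apply: pf_lift_basic => //; exact: gdom_dom.
- by rewrite gdom_mul // gdom_inv.
- by rewrite gmulgVK.
Qed.

(** The prime filters that avoid the ideal of all [x <= t] are those that avoid
    [t] itself. *)
Lemma basic_nle s t : @pf_basic S s `<=` pf_basic t -> nle s t.
Proof.
move=> st; apply: contrapT => nst.
have [||||A [pA As AI]] := @prime_filter_exists S [set x | nle x t] s.
- exact: nle0.
- by move=> a b /= bt ab; exact: nle_trans bt.
- by move=> a b j /is_join2P[_ _ lub] at_ bt; exact: lub.
- exact: nst.
by apply: (AI t); [exact: (st (PrimeFilter pA))|exact: nle_refl].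
Qed.

Lemma basic_cob_inj : injective basic_cob.
Proof.
by move=> s t /(congr1 (@cob_set P)) /= st; apply: nle_anti; apply: basic_nle;
  rewrite st.
Qed.

Lemma basic_join s t j : is_join [set s; t] j ->
  @pf_basic S j = pf_basic s `|` pf_basic t.
Proof.
move=> jJ; have /is_join2P[sj tj _] := jJ; apply/seteqP; split=> A.
  exact: (pf_prime (pf_setP A) jJ).
by move=> [As|At]; [exact: pf_mem_nle sj As|exact: pf_mem_nle tj At].
Qed.

(** Compatibility is a pair of equations between products and inverses, which an
    injective homomorphism reflects. *)
Lemma basic_compatible s t :
  compatible (basic_cob s) (basic_cob t) -> compatible s t.
Proof.
move=> [h1 h2]; split; apply: basic_cob_inj.
  by rewrite !basic_cobM morph_sinv //; exact: basic_cobM.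
by rewrite !basic_cobM morph_sinv //; exact: basic_cobM.
Qed.

(** The elements [s] with [pf_basic s] contained in [U] are pairwise compatible,
    so finitely many of them that cover [U] have a join. *)
Lemma basic_cob_surj (U : cobisection P) : exists s, basic_cob s = U.
Proof.
have [oU cU _] := cob_setP U.
have [s [sU Us]] : exists s,
  pf_basic s `<=` cob_set U /\ cob_set U `<=` pf_basic s.
  apply: (@compact_elim _ _ (fun X => exists s,
    pf_basic s `<=` cob_set U /\ X `<=` pf_basic s) cU).
  - by exists szero; split=> [A A0|A []]; case: (pf_zero (pf_setP A) A0).
  - by move=> A B AB [s [sU Bs]]; exists s; split=> // x /AB; exact: Bs.
  - move=> A B [s [sU As]] [t [tU Bt]].
    have [|j jJ] := @join_exists S s t.
      by apply: basic_compatible; apply: (@nle_compatible _ U); exact/cob_nleP.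
    exists j; rewrite (basic_join jJ); split=> x; first by move=> [/sU|/tU].
    by move=> [/As|/Bt]; [left|right].
  - move=> A UA; have [s As sU] := (open_pfP (cob_set U)).1 oU A UA.
    by exists (pf_basic s); split;
      [exact: open_basic|exact: As|by exists s; split].
by exists s; apply/cob_eq/seteqP.
Qed.

Definition basic_cob_inv (U : cobisection P) : S :=
  sval (cid (basic_cob_surj U)).

Lemma basic_cob_invK : cancel basic_cob_inv basic_cob.
Proof. by move=> U; rewrite /basic_cob_inv; case: cid. Qed.

Lemma basic_cobK : cancel basic_cob basic_cob_inv.
Proof. by move=> s; apply: basic_cob_inj; exact: basic_cob_invK. Qed.

Definition unit_from : callitic S (cobisection P) :=
  callitic_of_bij basic_cobK basic_cob_invK basic_cobM.

Definition unit_to : callitic (cobisection P) S :=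
  callitic_of_bij basic_cob_invK basic_cobK
    (bij_morph_inv basic_cobK basic_cob_invK basic_cobM).

End Unit.

Section BijectiveFunctor.
Variables (G H : topologicalGroupoidType) (f : G -> H) (g : H -> G).
Hypotheses (fK : cancel f g) (gK : cancel g f).
Hypotheses (fF : is_groupoid_functor f) (fC : continuous f) (gC : continuous g).

Lemma bij_functor_inv : is_groupoid_functor g.
Proof.
have [fd fc fm] := fF; split=> [x|x|x y xy]; apply: (can_inj fK).
- by rewrite fd !gK.
- by rewrite fc !gK.
- by rewrite fm ?gK //; apply: (can_inj fK); rewrite fd fc !gK.
Qed.

Lemma bij_is_covering : is_covering f.
Proof.
have [fd _ _] := fF; move=> e ie; split.
- by move=> x /= xe; rewrite -fd xe.
- by move=> x y _ _; exact: can_inj.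
by move=> y /= ye; exists (g y); rewrite //=; apply: (can_inj fK);
  rewrite fd gK.
Qed.

Lemma bij_is_coherent : is_coherent f.
Proof.
move=> U oU cU; split; first by move: oU; move: (U); exact/continuousP.
suff -> : f @^-1` U = g @` U.
  by apply: continuous_compact => //; exact: continuous_subspaceT.
apply/seteqP; split=> [x Ux|_ [y Uy <-]]; first by exists (f x).
by rewrite /preimage /= gK.
Qed.

Definition covering_of_bij : covering_functor G H :=
  CoveringFunctor fF bij_is_covering fC bij_is_coherent.

End BijectiveFunctor.

Section Counit.
Variable G : booleanGroupoidType.
Implicit Types (g h : G) (U V W : cobisection G).
Local Notation P := (prime_filter (cobisection G)).

Lemma point_prime g : is_prime_filter [set U : cobisection G | U g].
Proof.
split.
- have [U [pU Ug _]] := cob_base (@openT G) (I : setT g).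
  by exists (Cobisection pU).
- by move=> U V Ug /cob_nleP; apply.
- move=> U V Ug Vg; have [oU _ _] := cob_setP U; have [oV _ _] := cob_setP V.
  have [W [pW Wg WUV]] := cob_base (openI oU oV) (conj Ug Vg).
  by exists (Cobisection pW); split=> //; apply/cob_nleP => h /WUV[].
- by [].
by move=> U V W /cob_joinP WE /=; rewrite WE.
Qed.

Definition point_filter g : P := PrimeFilter (point_prime g).

Lemma cob_exists g : exists U : cobisection G, U g.
Proof. exact: pf_nonempty (point_prime g). Qed.

(** Two points of a bisection have different domains, and these are separated. *)
Lemma point_filter_inj : injective point_filter.
Proof.
move=> g h gh; have mem U : U g <-> U h by move: (congr1 (fun A : P => A U) gh) => /= ->.
have [U Ug] := cob_exists g; have Uh := (mem U).1 Ug.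
apply: (cob_bisection (cob_setP U)).1 => //; apply: contrapT => dgh.
have [sep _] := (locally_compact_boolean_subspaceP (@identities_open G)).1
  (@identities_boolean G).
have [V [W [oV oW Vg Wh VW]]] :=
  sep _ _ (identities_dom g) (identities_dom h) dgh.
have odV : open (@gdom G @^-1` V).
  by move: oV; move: (V); apply/continuousP; exact: gdom_continuous.
have [C [pC Cg CV]] := cob_base odV Vg.
have Ch : C h := (mem (Cobisection pC)).1 Cg.
by apply: (VW (gdom h)); [split=> //; exact: CV|exact: identities_dom].
Qed.

(** A cluster point [g] of [A] in a member [U] belongs to all members of [A], as
    the open set [U `\` V] misses [V] for each member [V] below [U]. Conversely,
    if [W] contains [g], then [A] contains a small bisection [C] around [g] or
    its complement in [U], and the latter does not cluster at [g]. *)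
Lemma point_filter_surj (A : P) : exists g, point_filter g = A.
Proof.
have [U AU] := pf_nonempty (pf_setP A); have [oU cU _] := cob_setP U.
pose F : set_system G :=
  [set X | exists2 W : cobisection G, A W & cob_set W `<=` X].
have FF : ProperFilter F.
  split.
    move=> [W AW W0]; apply: (pf_zero (pf_setP A)); apply: pf_mem_nle AW.
    by apply/cob_nleP => g /W0.
  split; first by exists U.
    move=> X Y [V AV VX] [W AW WY];
      have [C [AC CV CW]] := pf_down (pf_setP A) AV AW.
    by exists C => // g Cg; split;
      [apply/VX/(cob_nleP C V).1|apply/WY/(cob_nleP C W).1].
  by move=> X Y XY [V AV VX]; exists V => //; exact: subset_trans XY.
have [g [Ug clg]] : cob_set U `&` cluster F !=set0 by apply: cU; exists U.
exists g; apply: pf_eqP => W; split=> [Wg|AW].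
  have [oW _ _] := cob_setP W.
  have [C [pC Cg CUW]] := cob_base (openI oU oW) (conj Ug Wg).
  have [oC cC _] := pC; have CU : C `<=` cob_set U by move=> h /CUW[].
  pose D := Cobisection (is_cob_diff (cob_setP U) oC cC CU).
  have UJ : is_join [set Cobisection pC; D] U.
    by apply/cob_joinP; rewrite /= setDUK.
  have [AC|AD] := pf_prime (pf_setP A) UJ AU.
    by apply: pf_mem_nle AC; apply/cob_nleP => h /CUW[].
  have [|h [[_ nCh] Ch]] := clg (cob_set D) C _ (open_nbhs_nbhs (conj oC Cg)).
    by exists D.
  by case: (nCh Ch).
have [V [AV VU VW]] := pf_down (pf_setP A) AU AW.
suff Vg : V g by apply: ((cob_nleP V W).1 VW).
apply: contrapT => nVg; have [oV cV _] := cob_setP V.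
have [oD _ _] := is_cob_diff (cob_setP U) oV cV ((cob_nleP V U).1 VU).
have [|h [Vh [_ nVh]]] :=
  clg (cob_set V) _ _ (open_nbhs_nbhs (conj oD (conj Ug nVg))).
  by exists V.
exact: nVh Vh.
Qed.

Lemma point_filter_dom g : point_filter (gdom g) = gdom (point_filter g).
Proof.
have [U Ug] := cob_exists g; apply: pf_eqP => X.
rewrite (@pf_dom_mem _ (point_filter g) U X Ug); split=> [Xg|].
  by exists g, (gdom g); rewrite gcod_dom gmul_dom.
move=> [u [x [Uu Xx ux gE]]]; have ug : u = g.
  by apply: (cob_bisection (cob_setP U)).2 => //; rewrite gE gcod_mul.
suff -> : gdom g = x by [].
by rewrite -(gmulKg ux) -gE ug gmulVg.
Qed.

Lemma point_filter_cod g : point_filter (gcod g) = gcod (point_filter g).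
Proof.
by rewrite -!gdom_inv point_filter_dom; congr gdom; exact: pf_eq.
Qed.

Lemma point_filter_mul g h : gdom g = gcod h ->
  point_filter (gmul g h) = gmul (point_filter g) (point_filter h).
Proof.
move=> gh; have [U Ug] := cob_exists g; apply: pf_eqP => X.
rewrite (@pf_comp_mem _ (point_filter g) _ U X _ Ug); last first.
  by rewrite -point_filter_dom gh point_filter_cod.
split=> [Xgh|].
  exists (ginv g), (gmul g h); rewrite gdom_inv gcod_mul // gmulKg //;
    split=> //.
  by rewrite /sinv /= /gset_inv /= ginvK.
move=> [u [x [Uu Xx ux hE]]]; have ug : ginv u = g.
  apply: (cob_bisection (cob_setP U)).1 => //.
  by rewrite gdom_inv gh hE gcod_mul.
suff -> : gmul g h = x by [].
by rewrite -ug hE gmulKg.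
Qed.

Lemma point_filter_functor : is_groupoid_functor point_filter.
Proof. by split;
  [exact: point_filter_dom|exact: point_filter_cod|exact: point_filter_mul]. Qed.

Lemma point_filter_continuous : continuous point_filter.
Proof.
apply/continuousP => U /open_pfP oU; apply: open_local => g /= /oU[V Vg VU].
exists (cob_set V); split=> //; first exact: cob_open (cob_setP V).
by move=> h Vh; exact: (VU (point_filter h) Vh).
Qed.

Definition filter_point (A : P) : G := sval (cid (point_filter_surj A)).

Lemma filter_pointK : cancel filter_point point_filter.
Proof. by move=> A; rewrite /filter_point; case: cid. Qed.

Lemma point_filterK : cancel point_filter filter_point.
Proof. by move=> g; apply: point_filter_inj; exact: filter_pointK. Qed.

Lemma filter_point_continuous : continuous filter_point.
Proof.
apply/continuousP => W oW; apply/open_pfP => A /= WA.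
have [U [pU UA UW]] := cob_base oW WA.
have mem (B : P) : B (Cobisection pU) <-> U (filter_point B).
  by rewrite -{1}(filter_pointK B).
exists (Cobisection pU); first exact/mem.
by move=> B /mem UB; exact: UW.
Qed.

Definition counit_to : covering_functor G P :=
  covering_of_bij point_filterK filter_pointK point_filter_functor
    point_filter_continuous filter_point_continuous.

Definition counit_from : covering_functor P G :=
  covering_of_bij filter_pointK point_filterK
    (bij_functor_inv point_filterK filter_pointK point_filter_functor)
    filter_point_continuous point_filter_continuous.

End Counit.

Lemma basic_cob_natural (S T : booleanInverseSemigroupType) (theta : callitic S T)
    (s : S) :
  basic_cob (theta s) = cob_pullback (pullback_functor theta) (basic_cob s).
Proof. exact: cob_eq. Qed.

Lemma point_filter_natural (G H : booleanGroupoidType) (phi : covering_functor G H)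
    (g : G) :
  point_filter (phi g) = pf_pullback (pullback_callitic phi) (point_filter g).
Proof. exact: pf_eq. Qed.

Lemma unit_iso : natural_iso (functor_comp cobisection_functor filter_functor)
  (functor_id boolean_inverse_semigroups).
Proof.
exists (fun S : boolean_inverse_semigroups => @unit_to S) (fun S => @unit_from S).
- by move=> S; apply: callitic_eq => U; exact: basic_cob_invK.
- by move=> S; apply: callitic_eq => s; exact: basic_cobK.
move=> S T theta; apply: callitic_eq => U; apply: (@basic_cob_inj T).
rewrite /= basic_cob_invK basic_cob_natural; congr cob_pullback.
by rewrite basic_cob_invK.
Qed.

Lemma counit_iso : natural_iso (functor_comp filter_functor cobisection_functor)
  (functor_id (opposite boolean_groupoids)).
Proof.
exists (fun G : opposite boolean_groupoids => @counit_to G) (fun G => @counit_from G).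
- by move=> G; apply: covering_functor_eq => A; exact: filter_pointK.
- by move=> G; apply: covering_functor_eq => g; exact: point_filterK.
move=> G H phi; apply: covering_functor_eq => g.
exact/esym/point_filter_natural.
Qed.

Theorem theorem1p1 :
  dually_equivalent boolean_inverse_semigroups boolean_groupoids.
Proof.
exists filter_functor, cobisection_functor.
by split; constructor; [exact: unit_iso|exact: counit_iso].
Qed.
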